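(* Let $n,d\ge1$, $L>0$, and let $f_1,\dots,f_n,f_s,g:\mathbb{R}^d\to\mathbb{R}$ be convex and $L$-smooth. Suppose that $\frac1n\sum_{i=1}^nf_i(x)+2f_s(x)+g(x)$ has a minimizer over $\mathbb{R}^d$, and let $x^\star$ be such a minimizer. Consider the algorithm BiCoLoR described in the context (with $k=d$), with compressors satisfying the compressor assumption of the context with constants $\omega,\omega_s,\omega_{\mathrm{av}}\ge0$. Suppose that $0<\gamma\le\frac1L$, $$\rho=\rho_y=\frac{1}{2+\omega_{\mathrm{av}}+2\omega_s},\qquad \eta=\eta_y=\frac{C}{(1+2\omega+2\omega_s)(2+\omega_{\mathrm{av}}+2\omega_s)}$$ for some constant $C\in(0,1)$, and that for every $t\ge1$, $p_t=\sqrt{\frac{b}{a+t}}\in(0,1]$ for some $b\ge\frac1\eta$ and $a\ge b-1$. Let $u_y^\star:=\nabla g(x^\star)$ and $u_i^\star:=\nabla f_i(x^\star)$ for $i\in\{1,\dots,n\}$. For $\epsilon>0$ let $$T:=\left\lceil\frac{1}{2\epsilon}\left(\frac1\gamma\sum_{i=1}^n\|x_i^0-x^\star\|^2+\frac{2n}{\gamma}\|x_s^0-x^\star\|^2+\frac n\gamma\|y^0-x^\star\|^2+\frac{\gamma a}{\eta b}\sum_{i=1}^n\|u_i^0-u_i^\star\|^2+\frac{n\gamma a}{\eta b}\|u_y^0-u_y^\star\|^2\right)\right\rceil,$$ assumed to satisfy $T\ge1$, and let $\tilde t$ be chosen uniformly at random in $\{0,\dots,T-1\}$, independently of the algorithm.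 Then: (i) for every $\epsilon>0$, $$\mathbb{E}\left[\sum_{i=1}^n\mathcal{D}_{f_i}(x_i^{\tilde t},x^\star)+2n\,\mathcal{D}_{f_s}(x_s^{\tilde t},x^\star)+n\,\mathcal{D}_g(y^{\tilde t},x^\star)\right]\le\epsilon;$$ (ii) as $\epsilon\to0$, $$\mathbb{E}\left[\frac1\gamma\sum_{i=1}^n\|x_i^{\tilde t}-x_s^{\tilde t}\|^2\right]=\mathcal{O}(\sqrt\epsilon),\qquad\mathbb{E}\left[\frac n\gamma\|x_s^{\tilde t}-y^{\tilde t}\|^2\right]=\mathcal{O}(\sqrt\epsilon);$$ (iii) the expected number of communication rounds over the first $T\ge1$ iterations is $\sum_{t=1}^Tp_t=\Theta(\sqrt T)$, so that the bound in (i) is achieved with $\Theta(\sqrt T)=\Theta\left(\frac1{\sqrt\epsilon}\right)$ communication rounds in expectation; (iv) if moreover $\gamma=\Theta(\frac1L)$, $x_1^0=\cdots=x_n^0=x_s^0=y^0=:x^0$, $u_i^0=\nabla f_i(x^0)$ for every $i\in\{1,\dots,n\}$ and $u_y^0=\nabla g(x^0)$, then $\sqrt T=\Theta\left(\sqrt{\frac L\epsilon}\,\|x^0-x^\star\|\right)$. In (ii) and (iii) the constants hidden in $\mathcal{O}$ and $\Theta$ do not depend on $\epsilon$ (or $T$) but may depend on all other quantities; in (iv) the constants hidden in $\Theta$ may depend on $n,a,b,\eta$ and on the constants in $\gamma=\Theta(1/L)$, but not on $\epsilon$, $L$, $x^0$, $x^\star$ (as $\epsilon\to 0$).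
   Context: Norms and inner products are Euclidean; $[n]:=\{1,\dots,n\}$. A differentiable function is $L$-smooth if its gradient is $L$-Lipschitz. For a convex differentiable $\phi:\mathbb{R}^d\to\mathbb{R}$, the Bregman distance is $\mathcal{D}_\phi(x,x'):=\phi(x)-\phi(x')-\langle\nabla\phi(x'),x-x'\rangle\ge0$. Compressors. For $\omega\ge0$, $\mathbb{U}(\omega)$ is the set of random maps $\mathcal{C}:\mathbb{R}^d\to\mathbb{R}^d$ with $\mathbb{E}[\mathcal{C}(x)]=x$ and $\mathbb{E}\|\mathcal{C}(x)-x\|^2\le\omega\|x\|^2$ for every $x\in\mathbb{R}^d$. Compressor assumption. For every $t\ge0$ and $i\in[n]$: $\mathcal{C}_i^t\in\mathbb{U}(\omega)$ and $\mathcal{C}_s^t\in\mathbb{U}(\omega_s)$. The families $(\mathcal{C}_1^t,\dots,\mathcal{C}_n^t,\mathcal{C}_s^t)$ are independent for different $t$, and independent of all coin flips below. For each $t$, $\mathcal{C}_s^t$ is independent of $(\mathcal{C}_i^t)_{i=1}^n$. The $(\mathcal{C}_i^t)_{i=1}^n$ need not be mutually independent; $\omega_{\mathrm{av}}\ge0$ is a constant such that for every $t$ and every $(x_i)_{i=1}^n\in(\mathbb{R}^d)^n$, $$\mathbb{E}\left\|\frac1n\sum_{i=1}^n(\mathcal{C}_i^t(x_i)-x_i)\right\|^2\le\frac{\omega_{\mathrm{av}}}{n}\sum_{i=1}^n\|x_i\|^2.$$ Algorithm BiCoLoR (case $k=d$). Parameters: $\gamma,\eta,\eta_y,\rho,\rho_y>0$,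 probabilities $(p_t)_{t\ge1}$ in $(0,1]$. Deterministic initialization: $x_1^0,\dots,x_n^0,x_s^0,y^0\in\mathbb{R}^d$ arbitrary, and $u_1^0,\dots,u_n^0,u_s^0,u_y^0\in\mathbb{R}^d$ with $\frac1n\sum_{i=1}^nu_i^0+2u_s^0+u_y^0=0$. For $t=0,1,\dots$: 1. $\hat x_i^t:=x_i^t-\gamma\nabla f_i(x_i^t)+\gamma u_i^t$ for $i\in\{1,\dots,n,s\}$, and $\hat y^t:=y^t-\gamma\nabla g(y^t)+\gamma u_y^t$. 2. Draw $\theta^t\in\{0,1\}$ with $\mathrm{Prob}(\theta^t=1)=p_{t+1}$ (independently of everything else). 3. If $\theta^t=1$ (a communication round): $c_i^t:=\mathcal{C}_i^t(\hat x_i^t-\hat y^t)$ for $i\in[n]$, $c_s^t:=\mathcal{C}_s^t(\hat x_s^t-\hat y^t)$, $\bar c^t:=\frac1n\sum_{i=1}^nc_i^t$, and for $i\in[n]$ $$x_i^{t+1}:=(1-\rho)\hat x_i^t+\rho(c_s^t+\hat y^t),\quad x_s^{t+1}:=\Big(1-\tfrac{\rho+\rho_y}{2}\Big)\hat x_s^t+\tfrac{\rho+\rho_y}{2}\hat y^t+\tfrac\rho2\bar c^t,\quad y^{t+1}:=\hat y^t+\rho_yc_s^t,$$ $$u_i^{t+1}:=u_i^t-\tfrac{p_{t+1}\eta}{\gamma}(c_i^t-c_s^t),\quad u_y^{t+1}:=u_y^t+\tfrac{p_{t+1}\eta_y}{\gamma}c_s^t,\quad u_s^{t+1}:=u_s^t+\tfrac{p_{t+1}\eta}{2\gamma}\bar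 c^t-\tfrac{p_{t+1}(\eta_y+\eta)}{2\gamma}c_s^t.$$ 4. If $\theta^t=0$: $x_i^{t+1}:=\hat x_i^t$, $u_i^{t+1}:=u_i^t$ for $i\in\{1,\dots,n,s\}$, $y^{t+1}:=\hat y^t$, $u_y^{t+1}:=u_y^t$. *)

(* Defs.v *)
From HB Require Import structures.
From mathcomp Require Import all_boot all_order all_algebra.
From mathcomp Require Import all_classical all_reals all_analysis.

Set Implicit Arguments.
Unset Strict Implicit.
Unset Printing Implicit Defensive.

Import Order.TTheory GRing.Theory Num.Theory.
Import numFieldNormedType.Exports.

Local Open Scope classical_set_scope.
Local Open Scope ring_scope.

Section euclidean.
Context {R : realType} {d : nat}.
Implicit Types x y : 'rV[R]_d.

Definition dot x y : R := \sum_(j < d) x 0 j * y 0 j.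

(* The norm `|x| of the library on row vectors is the sup norm; it is used here
   only through the topology it induces (differentiability, Borel sets). *)
Definition enorm x : R := Num.sqrt (dot x x).

Definition grad (f : 'rV[R]_d -> R) x : 'rV[R]_d :=
  \row_(j < d) 'd f x (delta_mx 0 j).

Definition smooth (L : R) (f : 'rV[R]_d -> R) : Prop :=
  (forall x, differentiable f x) /\
  (forall x y, enorm (grad f x - grad f y) <= L * enorm (x - y)).

Definition convex (f : 'rV[R]_d -> R) : Prop :=
  convex_function [set: 'rV[R]_d] f.

Definition bregman (f : 'rV[R]_d -> R) x x' : R :=
  f x - f x' - dot (grad f x') (x - x').

End euclidean.

Section independence.
Context {R : realType} {dO : measure_display} {Omega : measurableType dO}.
Variable P : probability Omega R.

Definition sub_sigma_algebra (F : set_system Omega) : Prop :=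
  sigma_algebra setT F /\ F `<=` measurable.

Definition independent (F G : set_system Omega) : Prop :=
  forall A B, F A -> G B -> P (A `&` B) = (P A * P B)%E.

Definition mutually_independent (I : eqType) (F : I -> set_system Omega) :
    Prop :=
  forall (J : seq I) (A : I -> set Omega), uniq J ->
    (forall j, j \in J -> F j (A j)) ->
    P (\big[setI/setT]_(j <- J) A j) = (\prod_(j <- J) P (A j))%E.

Definition sigma_of {d' : measure_display} {U : measurableType d'}
  (X : Omega -> U) : set_system Omega := preimage_set_system setT X measurable.

Definition uniform_below (T : nat) (X : Omega -> nat) : Prop :=
  forall k, P (X @^-1` [set k]) = (if (k < T)%N then T%:R^-1 else 0)%:E.

End independence.

Section compressors.
Context {R : realType} {d n : nat}.
Local Notation V := 'rV[R]_d.
Context {dO : measure_display} {Omega : measurableType dO}.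
Variable P : probability Omega R.

Local Notation borel := (g_sigma_algebraType (@open V)).

(* F carries the randomness of C. Joint measurability in the sample and in the
   argument is what makes C(x) well behaved when x is itself random; measurability
   of w |-> C w x for each fixed x would not suffice: the independence of C from
   a random X would not even give E[C(X)] = E[X]. *)
Definition random_map (F : set_system Omega) (C : Omega -> V -> V) : Prop :=
  measurable_fun [set: (g_sigma_algebraType F * borel)%type]
    (fun z : g_sigma_algebraType F * borel => C z.1 z.2 : borel).

(* With the second condition, the coordinates of C w x are square integrable, so
   that the expectations in the first one are genuine. *)
Definition in_U (omega : R) (C : Omega -> V -> V) : Prop :=
  forall x : V,
    (forall j, 'E_P[fun w => (C w x 0 j)%R] = (x 0 j)%:E)%E /\
    ('E_P[fun w => (enorm (C w x - x) ^+ 2)%R] <= (omega * enorm x ^+ 2)%:E)%E.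

(* F t and Fs t are the sigma-algebras of the randomness of the family
   (C t i)_i and of Cs t, respectively. *)
Record compressor_assumption (omega omegas omegaav : R)
    (F Fs : nat -> set_system Omega)
    (C : nat -> 'I_n -> Omega -> V -> V) (Cs : nat -> Omega -> V -> V)
    (theta : nat -> {RV P >-> bool}) : Prop := {
  workers_sigma : forall t, sub_sigma_algebra (F t) ;
  server_sigma : forall t, sub_sigma_algebra (Fs t) ;
  workers_random : forall t i, random_map (F t) (C t i) ;
  server_random : forall t, random_map (Fs t) (Cs t) ;
  workers_in_U : forall t i, in_U omega (C t i) ;
  server_in_U : forall t, in_U omegas (Cs t) ;
  workers_average : forall t (x : 'I_n -> V),
    ('E_P[fun w => (enorm (n%:R^-1 *: \sum_(i < n) (C t i w (x i) - x i))
                    ^+ 2)%R]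
     <= (omegaav / n%:R * \sum_(i < n) enorm (x i) ^+ 2)%:E)%E ;
  rounds_coins_independent :
    mutually_independent P (fun s : nat + nat =>
      match s with
      | inl t => <<s F t `|` Fs t >>
      | inr t => sigma_of (theta t)
      end) ;
  workers_server_independent : forall t, independent P (F t) (Fs t)
}.

Definition algorithm_sigma (F Fs : nat -> set_system Omega)
    (theta : nat -> {RV P >-> bool}) : set_system Omega :=
  <<s \bigcup_t (F t `|` Fs t `|` sigma_of (theta t)) >>.

End compressors.

Section bicolor.
Context {R : realType} {n d : nat}.
Local Notation V := 'rV[R]_d.

Record state := State {
  xw : 'I_n -> V ; xs : V ; yv : V ;
  uw : 'I_n -> V ; us : V ; uy : V }.

Variables (gamma eta etay rho rhoy : R).
Variables (f : 'I_n -> V -> R) (fs g : V -> R).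

Definition local_step (h : V -> R) (x u : V) : V :=
  x - gamma *: grad h x + gamma *: u.

Definition bicolor_step (p : R) (theta : bool) (C : 'I_n -> V -> V)
    (Cs : V -> V) (z : state) : state :=
  let xh i := local_step (f i) (xw z i) (uw z i) in
  let xhs := local_step fs (xs z) (us z) in
  let yh := local_step g (yv z) (uy z) in
  if theta then
    let c i := C i (xh i - yh) in
    let cs := Cs (xhs - yh) in
    let cbar := n%:R^-1 *: \sum_(i < n) c i in
    {| xw := fun i => (1 - rho) *: xh i + rho *: (cs + yh) ;
       xs := (1 - (rho + rhoy) / 2) *: xhs + ((rho + rhoy) / 2) *: yh
             + (rho / 2) *: cbar ;
       yv := yh + rhoy *: cs ;
       uw := fun i => uw z i - (p * eta / gamma) *: (c i - cs) ;
       us := us z + (p * eta / (2 * gamma)) *: cbar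
             - (p * (etay + eta) / (2 * gamma)) *: cs ;
       uy := uy z + (p * etay / gamma) *: cs |}
  else
    {| xw := xh ; xs := xhs ; yv := yh ; uw := uw z ; us := us z ; uy := uy z |}.

Fixpoint bicolor {Omega : Type} (p : nat -> R) (theta : nat -> Omega -> bool)
    (C : nat -> 'I_n -> Omega -> V -> V) (Cs : nat -> Omega -> V -> V)
    (z0 : state) (t : nat) (w : Omega) : state :=
  if t is s.+1 then
    bicolor_step (p s.+1) (theta s w) (fun i => C s i w) (Cs s w)
      (bicolor p theta C Cs z0 s w)
  else z0.

End bicolor.

Arguments state : clear implicits.

Section horizon.
Context {R : realType} {n d : nat}.
Local Notation V := 'rV[R]_d.

Definition initial_energy (gamma eta a b : R) (f : 'I_n -> V -> R) (g : V -> R)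
    (xstar : V) (z0 : state R n d) : R :=
  gamma^-1 * \sum_(i < n) enorm (xw z0 i - xstar) ^+ 2
  + 2 * n%:R / gamma * enorm (xs z0 - xstar) ^+ 2
  + n%:R / gamma * enorm (yv z0 - xstar) ^+ 2
  + gamma * a / (eta * b)
    * \sum_(i < n) enorm (uw z0 i - grad (f i) xstar) ^+ 2
  + n%:R * gamma * a / (eta * b) * enorm (uy z0 - grad g xstar) ^+ 2.

(* The ceiling is an int; it is nonnegative in the intended range of parameters,
   so the absolute value only serves as the cast to nat. *)
Definition horizon (gamma eta a b : R) (f : 'I_n -> V -> R) (g : V -> R)
    (xstar : V) (z0 : state R n d) (eps : R) : nat :=
  `|Num.ceil ((2 * eps)^-1 * initial_energy gamma eta a b f g xstar z0)|%N.

End horizon.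

(* Main.v *)
Require Import Defs.
From HB Require Import structures.
From mathcomp Require Import all_boot all_order all_algebra.
From mathcomp Require Import all_classical all_reals all_analysis.
From mathcomp Require Import measurable_realfun ring lra.

Set Implicit Arguments.
Unset Strict Implicit.
Unset Printing Implicit Defensive.

Import Order.TTheory GRing.Theory Num.Theory.
Import numFieldNormedType.Exports.

Local Open Scope classical_set_scope.
Local Open Scope ring_scope.

(** Each local step contracts the squared distance to the minimizer up to twice
    [gamma] times a Bregman distance, by co-coercivity of the gradients.  A
    communication round moves the iterates towards a common consensus: for any
    fixed point [k], averaging with the weight [rho = 1 / (2 + omegaav + 2 omegas)]
    lowers the energy [sum |x_i - k|^2 + 2 n |x_s - k|^2 + n |y - k|^2] in
    expectation by [rho] times the dispersion of the local iterates, compression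
    noise included.  With the squared distances of the dual variables to the
    gradients at the minimizer, weighted by [gamma / (eta p_t^2)], the cross terms
    cancel, so this Lyapunov function decreases in expectation by twice the
    Bregman total plus a multiple of [p_t] times the dispersion; the choice of
    [p_t] is what makes successive weights differ by at most [gamma].  Telescoping
    over [t < T] gives (i), and (ii) since [p_t] is at least of order
    [1 / sqrt T].  Randomness enters only through one bound for a pair of
    independent variables (Fubini), used for the past against the present round,
    the coin against the compressors, and the workers against the server. *)

(** * Smooth convex functions *)

(** The dual weight may grow by [gamma] per iteration because a local step, seen as a gradient step
    shifted by [gamma *: u], leaves a surplus of [- gamma ^+ 2] times the squared dual error;
    multiplied by [gamma^-1], it pays for that growth. The dual variable [us] has no term in the
    Lyapunov function: the relation [conserved], which every update preserves, eliminates it from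
    the cross terms. The condition [C < 1] keeps the cost of the dual update, [C * rho] times the
    dispersion, below the [rho] gained by the primal averaging. Two obstacles shape the
    probabilistic part. No expectation is known to be finite in advance, so bounds are carried as
    inequalities on integrals of nonnegative functions, and finiteness is read off the telescoped
    sum. Moreover the dispersion that decreases is that of the iterates after the local steps,
    whereas (ii) is about the iterates themselves; a second use of the round inequality, around the
    local iterate of the server, transfers the bound to the next state at the price of a factor 2
    and of a separate term for the initial state. *)

Section euclidean_theory.
Context {R : realType} {d : nat}.
Local Notation V := 'rV[R]_d.
Implicit Types x y z : V.

Lemma dotC x y : dot x y = dot y x.
Proof. by apply: eq_bigr => j _; rewrite mulrC. Qed.

Lemma dotDl x y z : dot (x + y) z = dot x z + dot y z.
Proof. by rewrite -big_split; apply: eq_bigr => j _; rewrite mxE mulrDl. Qed.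

Lemma dotZl (k : R) x y : dot (k *: x) y = k * dot x y.
Proof. by rewrite mulr_sumr; apply: eq_bigr => j _; rewrite mxE mulrA. Qed.

Lemma dotNl x y : dot (- x) y = - dot x y.
Proof. by rewrite -scaleN1r dotZl mulN1r. Qed.

Lemma dotBl x y z : dot (x - y) z = dot x z - dot y z.
Proof. by rewrite dotDl dotNl. Qed.

Lemma dotDr x y z : dot x (y + z) = dot x y + dot x z.
Proof. by rewrite ![dot x _]dotC dotDl. Qed.

Lemma dotZr (k : R) x y : dot x (k *: y) = k * dot x y.
Proof. by rewrite ![dot x _]dotC dotZl. Qed.

Lemma dotNr x y : dot x (- y) = - dot x y.
Proof. by rewrite ![dot x _]dotC dotNl. Qed.

Lemma dotBr x y z : dot x (y - z) = dot x y - dot x z.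
Proof. by rewrite dotDr dotNr. Qed.

Lemma dot0l x : dot 0 x = 0.
Proof. by rewrite -(scale0r 0) dotZl mul0r. Qed.

Lemma dot_suml (I : Type) (r : seq I) (P : pred I) (F : I -> V) y :
  dot (\sum_(i <- r | P i) F i) y = \sum_(i <- r | P i) dot (F i) y.
Proof.
apply: (big_morph (fun x => dot x y) (fun x1 x2 => dotDl x1 x2 y)).
exact: dot0l.
Qed.

Lemma dot_ge0 x : 0 <= dot x x.
Proof. by apply: sumr_ge0 => j _; rewrite -expr2 sqr_ge0. Qed.

Lemma enorm_sqr x : enorm x ^+ 2 = dot x x.
Proof. by rewrite sqr_sqrtr ?dot_ge0. Qed.

Lemma enorm_ge0 x : 0 <= enorm x.
Proof. exact: sqrtr_ge0. Qed.

Lemma sqr_enorm_sum x : enorm x ^+ 2 = \sum_(j < d) x 0 j ^+ 2.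
Proof. by rewrite enorm_sqr; apply: eq_bigr => j _; rewrite expr2. Qed.

Lemma enormN x : enorm (- x) = enorm x.
Proof. by rewrite /enorm dotNl dotNr opprK. Qed.

Lemma enormZ_sqr (k : R) x : enorm (k *: x) ^+ 2 = k ^+ 2 * enorm x ^+ 2.
Proof. by rewrite !enorm_sqr dotZl dotZr mulrA expr2. Qed.

Lemma enormD_sqr x y :
  enorm (x + y) ^+ 2 = enorm x ^+ 2 + 2 * dot x y + enorm y ^+ 2.
Proof. by rewrite !enorm_sqr dotDl !dotDr (dotC y x); ring. Qed.

Lemma enormB_sqr x y :
  enorm (x - y) ^+ 2 = enorm x ^+ 2 - 2 * dot x y + enorm y ^+ 2.
Proof. by rewrite enormD_sqr dotNr enormN; ring. Qed.

Lemma enormD_sqr_le x y :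
  enorm (x + y) ^+ 2 <= 2 * enorm x ^+ 2 + 2 * enorm y ^+ 2.
Proof.
have := sqr_ge0 (enorm (x - y)); rewrite enormB_sqr enormD_sqr; lra.
Qed.

(** Young's inequality: expand the square of [k *: x - y] and divide by [k]. *)
Lemma dot_le_sqr (k : R) x y : 0 < k ->
  2 * dot x y <= k * enorm x ^+ 2 + k^-1 * enorm y ^+ 2.
Proof.
move=> k0; have := sqr_ge0 (enorm (k *: x - y)).
rewrite enormB_sqr enormZ_sqr dotZl => h.
have := mulr_ge0 (ltW (_ : 0 < k^-1)) h; rewrite invr_gt0 => /(_ k0).
have -> : k^-1 * (k ^+ 2 * enorm x ^+ 2 - 2 * (k * dot x y) + enorm y ^+ 2) =
  k * enorm x ^+ 2 - 2 * dot x y + k^-1 * enorm y ^+ 2.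
  by field; rewrite gt_eqF.
lra.
Qed.

Lemma enorm_eq0 x : enorm x = 0 -> x = 0.
Proof.
move=> x0; have : dot x x = 0 by rewrite -enorm_sqr x0 expr0n.
move=> /eqP; rewrite psumr_eq0 => [/allP xj0|j _]; last first.
  by rewrite -expr2 sqr_ge0.
apply/rowP => j; have := xj0 j (mem_index_enum _).
by rewrite -expr2 sqrf_eq0 mxE => /eqP.
Qed.

(** The weight [enorm y / enorm x] optimizes Young's inequality and makes both of its terms equal to
    [enorm x * enorm y]; zero vectors are set apart to keep the weight positive. *)
Lemma CauchySchwarz x y : dot x y <= enorm x * enorm y.
Proof.
have [/enorm_eq0 ->|xn0] := eqVneq (enorm x) 0.
  by rewrite dot0l mulr_ge0 ?enorm_ge0.
have [/enorm_eq0 ->|yn0] := eqVneq (enorm y) 0.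
  by rewrite dotC dot0l mulr_ge0 ?enorm_ge0.
have xp : 0 < enorm x by rewrite lt_def xn0 enorm_ge0.
have yp : 0 < enorm y by rewrite lt_def yn0 enorm_ge0.
have := dot_le_sqr x y (divr_gt0 yp xp).
have -> : enorm y / enorm x * enorm x ^+ 2 + (enorm y / enorm x)^-1 * enorm y ^+ 2
  = 2 * (enorm x * enorm y) by field; rewrite xn0 yn0.
lra.
Qed.

Lemma enormZ (k : R) x : enorm (k *: x) = `|k| * enorm x.
Proof.
by rewrite /enorm dotZl dotZr mulrA sqrtrM -expr2 ?sqr_ge0// sqrtr_sqr.
Qed.

End euclidean_theory.

Section smooth_convex.
Context {R : realType} {d : nat}.
Local Notation V := 'rV[R]_d.
Implicit Types (x y v z : V) (f : V -> R).

Lemma diff_dot_grad f x v : differentiable f x -> 'd f x v = dot (grad f x) v.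
Proof.
move=> df; rewrite {1}(row_sum_delta v) linear_sum.
by apply: eq_bigr => j _; rewrite linearZ mxE /= mulrC.
Qed.

(** The difference quotient of the restriction to the line is the directional difference quotient of
    [f] at [x + s *: v] along [v], so no chain rule is involved. *)
Lemma is_derive_segment f x v (s : R) : (forall z, differentiable f z) ->
  is_derive s 1 (fun s : R => f (x + s *: v)) (dot (grad f (x + s *: v)) v).
Proof.
move=> df; have /diff_derivable dv := df (x + s *: v).
have E : (fun h : R => h^-1 *: (((fun s : R => f (x + s *: v)) \o shift s) (h *: 1)
      - f (x + s *: v)))
    = (fun h : R => h^-1 *: ((f \o shift (x + s *: v)) (h *: v) - f (x + s *: v))).
  apply/funext => h /=; congr (_ *: (f _ - _)).
  by rewrite /shift/= [h *: 1]mulr1 scalerDl addrCA.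
apply: DeriveDef.
  by rewrite /derivable E; exact: dv.
by rewrite /derive E -diff_dot_grad // -deriveE.
Qed.

Lemma is_derive_sub_quadratic (g : R -> R) (s dg b c : R) :
  is_derive s 1 g dg ->
  is_derive s 1 (fun s => g s - s * b - c * s ^+ 2) (dg - b - 2 * c * s).
Proof.
move=> ?; apply: is_derive_eq; rewrite /GRing.scale /=.
by rewrite !mulr1 mulr0; ring.
Qed.

(** The passage to the limit [s -> 0], in the form used for the gradient inequality and for
    stationarity at a minimizer. *)
Lemma ler_small_slack (A B K : R) :
  (forall s, 0 < s -> s <= 1 -> A <= B + s * K) -> A <= B.
Proof.
move=> H; apply/ler_addgt0Pr => e e0.
have K1 : 0 < `|K| + 1 by rewrite ltr_wpDl.
pose s := Num.min 1 (e / (`|K| + 1)).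
have s0 : 0 < s by rewrite lt_min ltr01 divr_gt0.
apply: le_trans (H s s0 _) _; first by rewrite ge_min lexx.
rewrite lerD2l (le_trans (ler_norm _))// normrM gtr0_norm//.
have : s <= e / (`|K| + 1) by rewrite ge_min lexx orbT.
rewrite ler_pdivlMr// => h; apply: le_trans _ h.
by rewrite ler_pM2l// lerDl.
Qed.

(* [G] is the gradient of [f], abstract so that unification never unfolds it. *)
Variables (f : V -> R) (G : V -> V) (L : R).
Hypothesis fG : forall x v (s : R),
  is_derive s 1 (fun s => f (x + s *: v)) (dot (G (x + s *: v)) v).
Hypothesis GL : forall x y, enorm (G x - G y) <= L * enorm (x - y).

Lemma dot_lipschitz x v w (s : R) : 0 <= s ->
  dot (G (x + s *: v)) w - dot (G x) w <= s * L * (enorm v * enorm w).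
Proof.
move=> s0; rewrite -dotBl; apply: le_trans (CauchySchwarz _ _) _.
have h := GL (x + s *: v) x.
have e : x + s *: v - x = s *: v by rewrite addrC addKr.
rewrite e enormZ ger0_norm// in h.
apply: le_trans (ler_wpM2r (enorm_ge0 w) h) _.
by rewrite !mulrA (mulrC L).
Qed.

(** Removing from [f] along the segment its linear part and the quadratic [L / 2] term leaves a
    function [h] with nonpositive derivative, by the Lipschitz bound; the claim is [h 1 <= h 0],
    obtained without integrating the gradient. *)
Lemma descent_lemma x v :
  f (x + v) <= f x + dot (G x) v + L / 2 * enorm v ^+ 2.
Proof.
pose D (s : R) := dot (G (x + s *: v)) v - dot (G x) v
  - 2 * (L / 2 * enorm v ^+ 2) * s.
pose h (s : R) := f (x + s *: v) - s * dot (G x) v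
  - L / 2 * enorm v ^+ 2 * s ^+ 2.
have hD (s : R) : is_derive s 1 h (D s) by exact: is_derive_sub_quadratic.
have D0 (s : R) : 0 <= s -> D s <= 0.
  by move=> s0; have := dot_lipschitz x v v s0; rewrite /D; lra.
have h10 : h 1 <= h 0.
  apply: (@ler0_derive1_le_cc R h 0 1); rewrite ?in_itv/= ?lexx ?ler01//.
  - move=> s; rewrite in_itv/= derive1E => /andP[/ltW s0 _].
    by have [_ ->] := hD s; exact: D0 s0.
  - by apply: derivable_within_continuous => s _; have [] := hD s.
by move: h10; rewrite /h scale1r scale0r addr0; lra.
Qed.

Lemma descent_lemma_back x v :
  f x <= f (x + v) - dot (G (x + v)) v + L / 2 * enorm v ^+ 2.
Proof.
have := descent_lemma (x + v) (- v).
by rewrite addrK dotNr enormN.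
Qed.

Hypothesis cf : convex f.

Lemma convex_grad_leD x v : dot (G x) v <= f (x + v) - f x.
Proof.
(* The slack [3 / 2] is [1 / 2] from the backward descent bound plus [1] for moving the gradient
   from [x + s *: v] to [x]. *)
apply: (@ler_small_slack _ _ (3 / 2 * L * enorm v ^+ 2)) => s s0 s1.
have h1 := descent_lemma_back x (s *: v); rewrite enormZ_sqr dotZr in h1.
have h2 : f (x + s *: v) <= f x + s * (f (x + v) - f x).
  have s01 : (0 <= s <= 1)%R by rewrite (ltW s0).
  have /andP[s0' s1'] := s01.
  have := cf (Itv01 s0' s1') (in_setT (x + v)) (in_setT x).
  rewrite !convRE /= /unstable.onem.
  have -> : conv (Itv01 s0' s1') ((x + v) : convex_lmodType V)
      (x : convex_lmodType V) = x + s *: v.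
    rewrite /conv /= /unstable.onem.
    by rewrite scalerDr scalerBl scale1r addrC addrA subrK.
  move=> h; apply: le_trans h _; lra.
have h3 := ler_wpM2l (ltW s0) (dot_lipschitz x v (- v) (ltW s0)).
rewrite !dotNr enormN in h3.
rewrite -(ler_pM2l s0); lra.
Qed.

Lemma convex_grad_le x y : dot (G x) (y - x) <= f y - f x.
Proof. by have := convex_grad_leD x (y - x); rewrite subrKC. Qed.

(* Apply the gradient inequality at the point reached from [y] by one gradient
   step on the tilted function [f - dot (G x)], minimal at [x]. *)
Lemma cocoercive x y : 0 < L ->
  enorm (G y - G x) ^+ 2 <= 2 * L * (f y - f x - dot (G x) (y - x)).
Proof.
move=> L0; set H := G y - G x.
have h1 := descent_lemma y (- (L^-1 *: H)).
have h2 := convex_grad_le x (y - L^-1 *: H).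
rewrite enormN enormZ_sqr dotNr dotZr in h1.
rewrite addrAC (dotBr (G x) (y - x)) dotZr in h2.
have E1 : dot (G y) H - dot (G x) H = enorm H ^+ 2 by rewrite -dotBl enorm_sqr.
move: h1 h2 E1; move: (dot (G y) H) (dot (G x) H) (dot (G x) (y - x)) => p q r.
move: (enorm H ^+ 2) (f y) (f x) (f _) => e b c a h1 h2 E1.
have E2 : L / 2 * (L^-1 ^+ 2 * e) = L^-1 * e / 2 by field; rewrite gt_eqF.
have h3 : L^-1 * e / 2 <= b - c - r.
  have E3 : L^-1 * p = L^-1 * q + L^-1 * e by rewrite -E1; ring.
  rewrite E2 E3 in h1; lra.
have := ler_wpM2l (ltW L0) h3.
have -> : L * (L^-1 * e / 2) = e / 2 by field; rewrite gt_eqF.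
lra.
Qed.

(** The cross term of the expanded square is [2 * gamma] times the sum of the Bregman distances in
    both directions. Since [gamma * L <= 1], co-coercivity lets the distance from [y] to [x] absorb
    the squared gradient difference, and the one from [x] to [y] remains. *)
Lemma gradient_step gamma x y : 0 < L -> 0 < gamma -> gamma <= L^-1 ->
  enorm ((x - gamma *: G x) - (y - gamma *: G y)) ^+ 2 <=
  enorm (x - y) ^+ 2 - 2 * gamma * (f x - f y - dot (G y) (x - y)).
Proof.
move=> L0 g0 gL.
have -> : (x - gamma *: G x) - (y - gamma *: G y) =
   (x - y) - gamma *: (G x - G y).
  by rewrite scalerBr !opprD !opprK addrACA.
rewrite [X in X <= _]enormB_sqr enormZ_sqr dotZr.
have co := cocoercive y x L0; have co' := cocoercive x y L0.
have B0 := convex_grad_le x y.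
have e : y - x = - (x - y) by rewrite opprB.
rewrite e dotNr in B0 co'.
have eG : enorm (G y - G x) = enorm (G x - G y) by rewrite -enormN opprB.
rewrite eG in co'; rewrite (dotC (x - y)) dotBl.
have gL1 : gamma * L <= 1 by rewrite -(mulVf (lt0r_neq0 L0)) ler_pM2r.
move: co' B0; move: (enorm (G x - G y) ^+ 2) (dot (G x) _) (dot (G y) _).
move: (f x) (f y) (enorm _ ^+ 2) => a b c e' p q co' B0.
have h : gamma ^+ 2 * e' <= 2 * gamma * (b - a + p).
  apply: le_trans (ler_wpM2l (sqr_ge0 _) co') _.
  have B1 : 0 <= b - a + p by lra.
  have := ler_wpM2l (mulr_ge0 (ltW g0) B1) gL1; lra.
lra.
Qed.

End smooth_convex.

Section grad_smooth.
Context {R : realType} {d : nat}.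
Implicit Types (L : R) (f : 'rV[R]_d -> R).

Lemma smooth_is_derive L f : smooth L f -> forall x v (s : R),
  is_derive s 1 (fun s => f (x + s *: v)) (dot (grad f (x + s *: v)) v).
Proof. by move=> [df _] x v s; exact: is_derive_segment. Qed.

Lemma bregman_ge0 L f x y : convex f -> smooth L f -> 0 <= bregman f x y.
Proof.
move=> cf sf; rewrite /bregman subr_ge0.
exact: (convex_grad_le (smooth_is_derive sf) sf.2 cf).
Qed.

Lemma bregman_gradient_step L f gamma x y :
  convex f -> smooth L f -> 0 < L -> 0 < gamma -> gamma <= L^-1 ->
  enorm ((x - gamma *: grad f x) - (y - gamma *: grad f y)) ^+ 2 <=
  enorm (x - y) ^+ 2 - 2 * gamma * bregman f x y.
Proof.
by move=> cf sf; exact: (gradient_step (smooth_is_derive sf) sf.2 cf).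
Qed.

End grad_smooth.

(** Moving from the minimizer by [- s *: G], with [G] the total gradient, would lower the objective
    by [s * enorm G ^+ 2] up to a term of order [s ^+ 2]; minimality and [s -> 0] leave [G = 0]. *)
Lemma descent_optimality (R : realType) (d n : nat) (L : R)
    (f : 'I_n -> 'rV[R]_d -> R) (fs g : 'rV[R]_d -> R) (xstar : 'rV[R]_d)
    (Gf : 'I_n -> 'rV[R]_d) (Gs Gg : 'rV[R]_d) :
  (forall i v,
    f i (xstar + v) <= f i xstar + dot (Gf i) v + L / 2 * enorm v ^+ 2) ->
  (forall v, fs (xstar + v) <= fs xstar + dot Gs v + L / 2 * enorm v ^+ 2) ->
  (forall v, g (xstar + v) <= g xstar + dot Gg v + L / 2 * enorm v ^+ 2) ->
  (forall x, n%:R^-1 * (\sum_(i < n) f i xstar) + 2 * fs xstar + g xstar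
             <= n%:R^-1 * (\sum_(i < n) f i x) + 2 * fs x + g x) ->
  n%:R^-1 *: (\sum_(i < n) Gf i) + 2 *: Gs + Gg = 0.
Proof.
move=> dlf dls dlg opt.
set G := (X in X = 0).
have : enorm G ^+ 2 <= 0.
  (* The factor is the total weight of the objective: [3] for [fs] and [g], and [n%:R^-1 * n%:R] for
     the average, kept unreduced because [n] may be zero here. *)
  apply: (@ler_small_slack _ _ _ ((n%:R^-1 * n%:R + 3) * L / 2 * enorm G ^+ 2)).
  move=> s s0 _; rewrite add0r.
  have h0 := opt (xstar + (- s) *: G).
  have h1 : n%:R^-1 * \sum_(i < n) f i (xstar + (- s) *: G) <= n%:R^-1 * \sum_(i < n)
     (f i xstar + dot (Gf i) ((- s) *: G) + L / 2 * enorm ((- s) *: G) ^+ 2).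
    by rewrite ler_wpM2l ?invr_ge0 ?ler0n// ler_sum// => i _; exact: dlf.
  rewrite !big_split/= sumr_const card_ord -dot_suml enormZ_sqr in h1.
  have h2 := dls ((- s) *: G).
  have h3 := dlg ((- s) *: G).
  rewrite !enormZ_sqr !dotZr in h1 h2 h3.
  have E : n%:R^-1 * dot (\sum_(i < n) Gf i) G + 2 * dot (Gs) G
       + dot (Gg) G = enorm G ^+ 2.
    by rewrite enorm_sqr [in RHS]/G !dotDl !dotZl.
  rewrite -mulr_natl in h1.
  rewrite -(ler_pM2l s0) -{1}E; lra.
move=> h; apply: enorm_eq0; apply/eqP.
by rewrite -sqrf_eq0; apply/eqP/le_anti; rewrite h sqr_ge0.
Qed.

Lemma first_order_optimality (R : realType) (d n : nat) (L : R)
    (f : 'I_n -> 'rV[R]_d -> R) (fs g : 'rV[R]_d -> R) (xstar : 'rV[R]_d) :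
  (forall i, smooth L (f i)) -> smooth L fs -> smooth L g ->
  (forall x, n%:R^-1 * (\sum_(i < n) f i xstar) + 2 * fs xstar + g xstar
             <= n%:R^-1 * (\sum_(i < n) f i x) + 2 * fs x + g x) ->
  n%:R^-1 *: (\sum_(i < n) grad (f i) xstar) + 2 *: grad fs xstar + grad g xstar
  = 0.
Proof.
move=> sf sfs sg; apply: (@descent_optimality _ _ _ L).
- by move=> i; exact: (descent_lemma (smooth_is_derive (sf i)) (sf i).2).
- exact: (descent_lemma (smooth_is_derive sfs) sfs.2).
- exact: (descent_lemma (smooth_is_derive sg) sg.2).
Qed.

(** * Independence *)

Section independence_theory.
Context {R : realType} {dO : measure_display} {Omega : measurableType dO}.
Variable P : probability Omega R.
Local Open Scope ereal_scope.

(** Conditioning on [X] in elementary form: by uniqueness of the product measure the law of the pair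
    is the product of the laws, and Tonelli lets the inner integral be bounded with the first
    variable frozen. Working with nonnegative extended reals avoids any integrability condition. *)
Lemma le_integral_independent_pair d1 d2 (T1 : measurableType d1)
    (T2 : measurableType d2) (X : Omega -> T1) (Y : Omega -> T2)
    (h : T1 * T2 -> \bar R) (g : T1 -> \bar R) :
  measurable_fun setT X -> measurable_fun setT Y ->
  (forall A B, measurable A -> measurable B ->
    P (X @^-1` A `&` Y @^-1` B) = P (X @^-1` A) * P (Y @^-1` B)) ->
  measurable_fun setT h -> (forall z, 0 <= h z) ->
  measurable_fun setT g -> (forall x, \int[P]_w h (x, Y w) <= g x) ->
  \int[P]_w h (X w, Y w) <= \int[P]_w g (X w).
Proof.
move=> mX mY XY mh h0 mg hg.
pose X' : {mfun Omega >-> T1} := HB.pack X (isMeasurableFun.Build _ _ _ _ _ mX).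
pose Y' : {mfun Omega >-> T2} := HB.pack Y (isMeasurableFun.Build _ _ _ _ _ mY).
have mXY := measurable_fun_pair mX mY.
pose Z : {mfun Omega >-> (T1 * T2)%type} :=
  HB.pack (fun w => (X w, Y w)) (isMeasurableFun.Build _ _ _ _ _ mXY).
have -> : \int[P]_w h (X w, Y w) = \int[distribution P Z]_z h z.
  by rewrite ge0_integral_distribution.
have -> : \int[distribution P Z]_z h z =
    \int[distribution P X' \x distribution P Y']_z h z.
  apply: eq_measure_integral => A mA _.
  by apply/esym/product_measure_unique => // B C mB mC; exact: XY.
have hF x : fubini_F (distribution P Y') h x = \int[P]_w h (x, Y w).
  by rewrite /fubini_F/= ge0_integral_distribution//=; exact: measurableT_comp.
have F0 x : 0 <= fubini_F (distribution P Y') h x by rewrite hF integral_ge0.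
have g0 x : 0 <= g x by apply: le_trans (F0 x) _; rewrite hF.
have -> : \int[P]_w g (X w) = \int[distribution P X']_x g x.
  by rewrite ge0_integral_distribution.
rewrite fubini_tonelli1//; apply: ge0_le_integral => //.
- exact: measurable_fun_fubini_tonelli_F.
- by move=> x _; rewrite hF.
Qed.

(** For a fixed event [B], the finite measures sending [A] to [P (A]&[B)] and to [P A * P B] agree
    on a class stable under intersection, hence on the sigma-algebra it generates. This extends one
    side; applying it again with the roles exchanged extends the other. *)
Lemma independent_generated (F G : set_system Omega) :
  F `<=` measurable -> G `<=` measurable -> F setT -> G setT ->
  setI_closed F -> setI_closed G ->
  independent P F G -> independent P <<s F >> <<s G >>.
Proof.
have half (H K : set_system Omega) : H `<=` measurable -> K `<=` measurable ->
    H setT -> setI_closed H -> independent P H K -> independent P <<s H >> K.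
  move=> Hm Km HT HI HK A B sA KB.
  have mB := Km _ KB.
  have PB0 : (0 <= fine (P B))%R by rewrite fine_ge0.
  pose m1 := mrestr P mB.
  pose m2 := mscale (NngNum PB0) P.
  have m2E C : m2 C = P C * P B.
    by rewrite muleC /m2 /mscale/= fineK// fin_num_measure.
  suff : m1 A = m2 A by rewrite m2E.
  apply: (g_sigma_algebra_measure_unique H Hm (fun=> setT)) => //.
  - by rewrite bigcup_const.
  - by move=> C HC; transitivity (P C * P B); [exact: HK|rewrite -m2E].
  - move=> _; apply: (@le_lt_trans _ _ 1%E); last exact: ltry.
    by apply: probability_le1; exact: measurableI.
move=> Fm Gm FT GT FI GI FG.
have h1 := half F G Fm Gm FT FI FG.
have sFm : <<s F >> `<=` measurable.
  exact: smallest_sub (@sigma_algebra_measurable _ Omega) Fm.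
have h2 : independent P <<s G >> <<s F >>.
  by apply: half => // A B GA FB; rewrite setIC muleC; exact: h1.
by move=> A B FA GB; rewrite setIC muleC; exact: h2.
Qed.

(** The pi-system generated by the blocks with index in [J]. The indices are kept distinct so that
    [mutually_independent] applies to its members as they stand. *)
Definition finite_meets (I : eqType) (F : I -> set_system Omega)
    (J : set I) : set_system Omega :=
  [set A | exists (s : seq I) (B : I -> set Omega),
    [/\ uniq s, (forall j, j \in s -> J j /\ F j (B j)) &
        A = \big[setI/setT]_(j <- s) B j]].

Lemma bigsetI_seqP (I : eqType) (s : seq I) (B : I -> set Omega) w :
  (\big[setI/setT]_(j <- s) B j) w <-> (forall j, j \in s -> B j w).
Proof.
elim: s => [|i s IH]; first by rewrite big_nil; split.
rewrite big_cons; split=> [[Biw /IH h] j|h].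
  by rewrite inE => /predU1P[->//|]; exact: h.
split; first by apply: h; rewrite mem_head.
by apply/IH => j js; apply: h; rewrite inE js orbT.
Qed.

Lemma finite_meets_setI (I : eqType) (F : I -> set_system Omega) (J : set I) :
  (forall i, sigma_algebra setT (F i)) -> setI_closed (finite_meets F J).
Proof.
move=> sF _ _ [s [B [us sB ->]]] [t [C [ut tC ->]]].
have FT i : F i setT.
  by have [F0 FC _] := sF i; rewrite -(setD0 setT); exact: FC.
have FI i A A' : F i A -> F i A' -> F i (A `&` A').
  have [/(_ (sF i)) [_ _ _ h] _] := sigma_algebraP (fun X (_ : F i X) => @subsetT _ X).
  exact: h.
(* An index present in only one of the two lists receives [setT] from the other, so that both meets
   are rewritten over the merged list. *)
pose D j := (if j \in s then B j else setT) `&` (if j \in t then C j else setT).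
exists (undup (s ++ t)), D; split.
- exact: undup_uniq.
- move=> j; rewrite mem_undup mem_cat /D => jst.
  split; first by case/orP: jst => [/sB[]|/tC[]].
  by apply: FI; [case: ifP => // /sB[] | case: ifP => // /tC[]].
- apply/seteqP; split=> w.
    move=> [/bigsetI_seqP hs /bigsetI_seqP ht]; apply/bigsetI_seqP => j _.
    by rewrite /D; split; case: ifP => // js; [exact: hs|exact: ht].
  move=> /bigsetI_seqP h; split; apply/bigsetI_seqP => j js.
    by have := h j; rewrite mem_undup mem_cat js /D js => /(_ isT) [].
  by have := h j; rewrite mem_undup mem_cat js orbT /D js => /(_ isT) [].
Qed.

(** As [J] and [K] are disjoint, a meet over [J] and a meet over [K] concatenate into a single meet
    over distinct indices, to which mutual independence applies; the generated sigma-algebras follow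
    from the pi-system criterion. *)
Lemma mutually_independent_blocks (I : eqType) (F : I -> set_system Omega)
    (J K : set I) :
  (forall i, sigma_algebra setT (F i)) -> (forall i, F i `<=` measurable) ->
  mutually_independent P F ->
  J `&` K = set0 ->
  independent P <<s \bigcup_(j in J) F j >> <<s \bigcup_(k in K) F k >>.
Proof.
move=> sF Fm mF JK.
have sub L : \bigcup_(i in L) F i `<=` finite_meets F L.
  move=> A [i Li FA]; exists [:: i], (fun=> A); split => //.
    by move=> j; rewrite inE => /eqP ->.
  by rewrite big_seq1.
have mm L : finite_meets F L `<=` measurable.
  move=> A [s [B [_ sB ->]]]; rewrite big_seq.
  by apply: bigsetI_measurable => i /sB[_]; exact: Fm.
have mT L : finite_meets F L setT.
  by exists [::], (fun=> setT); split => //; rewrite big_nil.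
have mI L : setI_closed (finite_meets F L) by exact: finite_meets_setI.
suff : independent P <<s finite_meets F J >> <<s finite_meets F K >>.
  move=> h A B sA sB; apply: h.
    exact: sub_sigma_algebra2 (sub J) _ sA.
  exact: sub_sigma_algebra2 (sub K) _ sB.
apply: independent_generated => // _ _ [s [A [us sA ->]]] [t [B [ut tB ->]]].
have st i : i \in s -> i \in t -> False.
  move=> /sA[Ji _] /tB[Ki _]; suff : (J `&` K) i by rewrite JK.
  by [].
pose D i := if i \in s then A i else B i.
have Ds : \big[setI/setT]_(j <- s) A j = \big[setI/setT]_(j <- s) D j.
  by apply: eq_big_seq => i si; rewrite /D si.
have Dt : \big[setI/setT]_(j <- t) B j = \big[setI/setT]_(j <- t) D j.
  apply: eq_big_seq => i ti; rewrite /D; case: ifP => // si.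
  by have := st i si ti.
have Fs i : i \in s -> F i (D i) by move=> si; rewrite /D si; case: (sA i si).
have Ft i : i \in t -> F i (D i).
  by move=> ti; rewrite /D; case: ifP => [/sA[]//|_]; case: (tB i ti).
have ust : uniq (s ++ t).
  rewrite cat_uniq us ut andbT /=; apply/hasPn => i ti; apply/negP => si.
  exact: st si ti.
have Fst i : i \in s ++ t -> F i (D i).
  by rewrite mem_cat => /orP[/Fs|/Ft].
by rewrite Ds Dt -big_cat (mF _ _ ust Fst) (mF _ _ us Fs) (mF _ _ ut Ft) big_cat.
Qed.

End independence_theory.

(** * Borel measurability in row vectors *)

Section borel_rV.
Context {R : realType} {d : nat}.
Local Notation V := 'rV[R]_d.
Local Notation borel := (g_sigma_algebraType (@open V)).

Lemma continuous_borel_measurable (h : V -> R) :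
  continuous h -> measurable_fun [set: borel] (h : borel -> R).
Proof.
move=> /continuousP ch.
apply: (measurability _ (RGenOInfty.measurableE R)) => _ [_ [x ->] <-].
rewrite setTI; apply: sub_sigma_algebra; exact/ch/interval_open.
Qed.

Context {dT : measure_display} {T : measurableType dT}.

(** Coordinates generate the Borel sets because an open set is the union of the boxes with rational
    center and radius [k.+1%:R^-1] that it contains, and there are countably many of these. *)
Lemma measurable_borel_coordP (X : T -> V) :
  measurable_fun setT (X : T -> borel) <->
  (forall j, measurable_fun setT (fun w => X w 0 j)).
Proof.
split=> [mX j|mX].
  have cj : continuous (fun x : V => x 0 j) by move=> x; exact: coord_continuous.
  exact: measurableT_comp (continuous_borel_measurable cj) mX.
pose box (c : 'rV[rat]_d * nat) : set V :=
  [set x | forall j, `|x 0 j - ratr (c.1 0 j)| < c.2.+1%:R^-1].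
apply: (@measurability _ _ _ borel setT X (@open V) erefl) => // _ [U oU <-]; rewrite setTI.
have -> : X @^-1` U = \bigcup_(c in [set c | box c `<=` U]) X @^-1` box c.
  apply/seteqP; split=> [w /= Uw|w [c /= cU]]; last exact: cU.
  have := oU; rewrite openE => /(_ _ Uw) /nbhs_ballP[e /= e0 eU].
  (* Half of [e] suffices: the point is within one radius of the rational center, and any point of
     the box within another. *)
  have [k ke] : exists k : nat, k.+1%:R^-1 < e / 2.
    have e2 : 0 < e / 2 by rewrite divr_gt0.
    exists (Num.truncn (e / 2)^-1).
    by rewrite invf_plt ?posrE// truncnS_gt.
  have qj j : exists q : rat, `|X w 0 j - ratr q| < k.+1%:R^-1.
    have /rat_in_itvoo[q qi] :
        X w 0 j - k.+1%:R^-1 < X w 0 j + k.+1%:R^-1.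
      by rewrite ltrD2l gt0_cp// invr_gt0.
    exists q; move: qi; rewrite in_itv/= => qi.
    by rewrite ltr_distlC.
  have [q qE] := choice qj.
  exists (\row_j q j, k) => /=; last by move=> j; rewrite mxE.
  move=> y /= hy; apply: eU; split=> // i j; rewrite !ord1 /ball/=.
  have := hy j; rewrite mxE => {}hy.
  rewrite (le_lt_trans (ler_distD (ratr (q j)) _ _))// (splitr e).
  rewrite ltrD ?(lt_trans (qE j))//.
  by rewrite distrC (lt_trans hy).
(* The inclusion [box c]<=[U] moves inside the sets, so that the union runs over a whole countable
   type; each term is then a box preimage or empty. *)
have -> : \bigcup_(c in [set c | box c `<=` U]) X @^-1` box c =
   \bigcup_c [set w | box c `<=` U /\ box c (X w)].
  by apply/seteqP; split=> w [c]; [exists c|move=> _ []; exists c].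
apply: countable_bigcupT_measurable; first exact: countableP.
move=> c; have [cU|ncU] := pselect (box c `<=` U); last first.
  by rewrite (_ : [set _ | _] = set0)//; apply/seteqP; split=> w [].
rewrite (_ : [set _ | _] =
    \bigcap_(j in [set: 'I_d]) [set w | `|X w 0 j - ratr (c.1 0 j)| < c.2.+1%:R^-1]).
  apply: fin_bigcap_measurable => // j _.
  have mf : measurable_fun setT (fun w => `|X w 0 j - ratr (c.1 0 j)|).
    by apply: measurableT_comp => //; exact: measurable_funB.
  have := mf measurableT _ (measurable_itv `]-oo, (c.2.+1%:R^-1 : R)[).
  by rewrite setTI.
by apply/seteqP; split=> w; [move=> [_ h] j _; exact: h|move=> h; split=> // j; exact: h].
Qed.

Lemma measurable_enorm_sqr (X : T -> V) : measurable_fun setT (X : T -> borel) ->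
  measurable_fun setT (fun w => enorm (X w) ^+ 2).
Proof.
move=> /measurable_borel_coordP mX.
under eq_fun do rewrite sqr_enorm_sum.
by apply: measurable_sum => j; exact: measurable_funX.
Qed.

Lemma measurable_borelD (X Y : T -> V) : measurable_fun setT (X : T -> borel) ->
  measurable_fun setT (Y : T -> borel) ->
  measurable_fun setT ((fun w => X w + Y w) : T -> borel).
Proof.
move=> /measurable_borel_coordP mX /measurable_borel_coordP mY.
apply/measurable_borel_coordP => j; under eq_fun do rewrite mxE.
exact: measurable_funD.
Qed.

Lemma measurable_borelZ (k : R) (X : T -> V) :
  measurable_fun setT (X : T -> borel) ->
  measurable_fun setT ((fun w => k *: X w) : T -> borel).
Proof.
move=> /measurable_borel_coordP mX.
apply/measurable_borel_coordP => j; under eq_fun do rewrite mxE.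
exact: measurable_funM.
Qed.

Lemma measurable_borelN (X : T -> V) : measurable_fun setT (X : T -> borel) ->
  measurable_fun setT ((fun w => - X w) : T -> borel).
Proof.
move=> mX; under eq_fun do rewrite -scaleN1r; exact: measurable_borelZ.
Qed.

Lemma measurable_borelB (X Y : T -> V) : measurable_fun setT (X : T -> borel) ->
  measurable_fun setT (Y : T -> borel) ->
  measurable_fun setT ((fun w => X w - Y w) : T -> borel).
Proof.
by move=> mX mY; apply: measurable_borelD => //; exact: measurable_borelN.
Qed.

Lemma measurable_borel_sum (I : Type) (s : seq I) (X : I -> T -> V) :
  (forall i, measurable_fun setT (X i : T -> borel)) ->
  measurable_fun setT ((fun w => \sum_(i <- s) X i w) : T -> borel).
Proof.
move=> mX; apply/measurable_borel_coordP => j.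
under eq_fun do rewrite summxE.
by apply: measurable_sum => i; have /measurable_borel_coordP := mX i.
Qed.

Lemma measurable_borel_if (b : T -> bool) (X Y : T -> V) :
  measurable_fun setT b -> measurable_fun setT (X : T -> borel) ->
  measurable_fun setT (Y : T -> borel) ->
  measurable_fun setT ((fun w => if b w then X w else Y w) : T -> borel).
Proof. by move=> mb mX mY; exact: measurable_fun_ifT. Qed.

Lemma enorm_le_sum (x : V) : enorm x <= \sum_(j < d) `|x 0 j|.
Proof.
rewrite -[leRHS]ger0_norm ?sumr_ge0// -sqrtr_sqr ler_wsqrtr// /dot.
suff [] : 0 <= \sum_(j < d) `|x 0 j| /\
    \sum_(j < d) x 0 j * x 0 j <= (\sum_(j < d) `|x 0 j|) ^+ 2 by [].
apply: (big_ind2 (fun a b : R => 0 <= a /\ b <= a ^+ 2)).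
- by rewrite expr0n.
- move=> a b c e [a0 ha] [c0 hc]; split; first exact: addr_ge0.
  rewrite sqrrD; have := mulr_ge0 a0 c0; lra.
- by move=> j _; rewrite real_normK ?num_real// expr2.
Qed.

Lemma smooth_continuous L (f : V -> R) : smooth L f -> continuous f.
Proof. by move=> [df _] x; exact: differentiable_continuous. Qed.

(** The Lipschitz bound is Euclidean whereas the topology comes from the sup norm; the comparison
    costs a factor [d], and the [+ 1] in the radius keeps the denominator positive. *)
Lemma lipschitz_coord_continuous (L : R) (G : V -> V) (j : 'I_d) :
  (forall x y, enorm (G x - G y) <= L * enorm (x - y)) ->
  continuous (fun x => G x 0 j).
Proof.
move=> GL x; apply/(@cvgrPdist_lt _ R^o V (nbhs x)) => e e0.
have K0 : 0 < `|L| * d%:R + 1 by rewrite ltr_wpDl// mulr_ge0.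
apply/nbhs_ballP; exists (e / (`|L| * d%:R + 1)); first by rewrite /= divr_gt0.
move=> y [_ xy] /=.
have h1 : `|G x 0 j - G y 0 j| <= enorm (G x - G y).
  rewrite -sqrtr_sqr ler_wsqrtr// /dot (bigD1 j)//= !mxE -expr2 lerDl.
  by apply: sumr_ge0 => i _; rewrite -expr2 sqr_ge0.
apply: le_lt_trans h1 _; apply: le_lt_trans (GL x y) _.
have h2 : enorm (x - y) <= d%:R * (e / (`|L| * d%:R + 1)).
  apply: le_trans (enorm_le_sum _) _.
  rewrite mulr_natl -[X in _ *+ X](card_ord d) -sumr_const ler_sum// => i _.
  have := xy 0 i; rewrite /ball/= => /ltW; rewrite !mxE; exact.
apply: (@le_lt_trans _ _ (`|L| * (d%:R * (e / (`|L| * d%:R + 1))))).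
  apply: le_trans (ler_wpM2r (enorm_ge0 _) (ler_norm L)) _.
  by rewrite ler_wpM2l.
rewrite !mulrA ltr_pdivrMr// mulrC ltr_pM2l// ltrDl.
exact: ltr01.
Qed.

Lemma measurable_smooth L (f : V -> R) (X : T -> V) : smooth L f ->
  measurable_fun setT (X : T -> borel) -> measurable_fun setT (f \o X).
Proof.
move=> /smooth_continuous cf mX.
exact: measurableT_comp (continuous_borel_measurable cf) mX.
Qed.

Lemma measurable_grad L (f : V -> R) (X : T -> V) : smooth L f ->
  measurable_fun setT (X : T -> borel) ->
  measurable_fun setT ((fun w => grad f (X w)) : T -> borel).
Proof.
move=> [_ fL] mX; apply/measurable_borel_coordP => j.
have cj := lipschitz_coord_continuous (j := j) fL.
exact: measurableT_comp (continuous_borel_measurable cj) mX.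
Qed.

Lemma measurable_dot (X : T -> V) (v : V) :
  measurable_fun setT (X : T -> borel) ->
  measurable_fun setT (fun w => dot v (X w)).
Proof.
move=> /measurable_borel_coordP mX; rewrite /dot.
by apply: measurable_sum => j; exact: measurable_funM.
Qed.

Lemma measurable_bregman L (f : V -> R) (X : T -> V) (y : V) : smooth L f ->
  measurable_fun setT (X : T -> borel) ->
  measurable_fun setT (fun w => bregman f (X w) y).
Proof.
move=> sf mX; apply: measurable_funB.
  by apply: measurable_funB => //; exact: measurable_smooth sf mX.
by apply: measurable_dot; apply: measurable_borelB => //.
Qed.

End borel_rV.

(** * Bounds on expectations of nonnegative variables *)

Section mean_le.
Context {R : realType} {dO : measure_display} {Omega : measurableType dO}.
Variable P : probability Omega R.

(** An upper bound on an expectation, bundled with the measurability and nonnegativity that make the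
    integral additive and monotone. It does not presuppose integrability but yields it. *)
Definition mean_le (f : Omega -> R) (a : R) : Prop :=
  [/\ measurable_fun setT f, (forall w, 0 <= f w) &
      (\int[P]_w (f w)%:E <= a%:E)%E].

Lemma mean_leW (f : Omega -> R) (a b : R) : a <= b -> mean_le f a -> mean_le f b.
Proof.
by move=> ab [mf f0 fa]; split=> //; apply: le_trans fa _; rewrite lee_fin.
Qed.

Lemma eq_mean_le (f h : Omega -> R) (a : R) : f =1 h -> mean_le f a -> mean_le h a.
Proof. by move=> /funext ->. Qed.

Lemma mean_leD (f h : Omega -> R) (a b : R) : mean_le f a -> mean_le h b ->
  mean_le (fun w => f w + h w) (a + b).
Proof.
move=> [mf f0 fa] [mh h0 hb]; split; first exact: measurable_funD.
  by move=> w; exact: addr_ge0.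
under eq_integral do rewrite EFinD.
rewrite ge0_integralD//; first by rewrite EFinD leeD.
- by move=> w _; rewrite lee_fin.
- exact/measurable_EFinP.
- by move=> w _; rewrite lee_fin.
- exact/measurable_EFinP.
Qed.

Lemma mean_leZ (k : R) (f : Omega -> R) (a : R) : 0 <= k -> mean_le f a ->
  mean_le (fun w => k * f w) (k * a).
Proof.
move=> k0 [mf f0 fa]; split; first exact: measurable_funM.
  by move=> w; exact: mulr_ge0.
under eq_integral do rewrite EFinM.
rewrite ge0_integralZl//; first by rewrite EFinM lee_wpmul2l.
- exact/measurable_EFinP.
- by move=> w _; rewrite lee_fin.
Qed.

Lemma mean_le_cst (k : R) : 0 <= k -> mean_le (fun=> k) k.
Proof.
move=> k0; split => //.
by have := expectation_cst P k; rewrite unlock => ->.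
Qed.

Lemma mean_le_sum (I : Type) (s : seq I) (f : I -> Omega -> R) (a : I -> R) :
  (forall i, mean_le (f i) (a i)) ->
  mean_le (fun w => \sum_(i <- s) f i w) (\sum_(i <- s) a i).
Proof.
move=> fa; elim: s => [|i s IH].
  under [X in mean_le X]funext do rewrite big_nil.
  by rewrite big_nil; exact: mean_le_cst.
under [X in mean_le X]funext do rewrite big_cons.
by rewrite big_cons; exact: mean_leD.
Qed.

Context {d : nat}.
Local Notation V := 'rV[R]_d.
Local Notation borel := (g_sigma_algebraType (@open V)).

(** On a probability space a second moment dominates a first one, through [y <= 1 + y ^+ 2]. *)
Lemma integrable_coord (X : Omega -> V) (m : V) (s : R) (j : 'I_d) :
  measurable_fun setT (X : Omega -> borel) ->
  mean_le (fun w => enorm (X w - m) ^+ 2) s ->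
  P.-integrable setT (EFin \o (fun w => X w 0 j)).
Proof.
move=> mX [mf _ fs].
have mXj : measurable_fun setT (fun w => X w 0 j).
  by have /measurable_borel_coordP := mX.
have h : mean_le (fun w => 1 + `|m 0 j| + enorm (X w - m) ^+ 2)
    (1 + `|m 0 j| + s).
  apply: mean_leD; first by apply: mean_le_cst; rewrite addr_ge0.
  by split=> // w; exact: sqr_ge0.
apply: (@le_integrable _ _ _ _ _ measurableT _
  (EFin \o (fun w => 1 + `|m 0 j| + enorm (X w - m) ^+ 2))).
- exact/measurable_EFinP.
- move=> w _ /=; rewrite lee_fin.
  rewrite [leRHS]ger0_norm ?addr_ge0 ?sqr_ge0//.
  have : (X w 0 j - m 0 j) ^+ 2 <= enorm (X w - m) ^+ 2.
    rewrite sqr_enorm_sum (bigD1 j)//= !mxE lerDl.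
    by apply: sumr_ge0 => i _; exact: sqr_ge0.
  have := ler_normD (X w 0 j - m 0 j) (m 0 j); rewrite subrK.
  have : `|X w 0 j - m 0 j| <= 1 + (X w 0 j - m 0 j) ^+ 2.
    rewrite -(real_normK (num_real (X w 0 j - m 0 j))).
    by move: `|_| (normr_ge0 (X w 0 j - m 0 j)) => y y0; nra.
  lra.
- have [mh h0 hs] := h; apply/integrableP; split; first exact/measurable_EFinP.
  under eq_integral do rewrite /= ger0_norm//.
  by apply: le_lt_trans hs _; rewrite ltry.
Qed.

(** Bias and variance: around [v = k + a *: m] the square splits into the nonnegative [f1] and the
    cross term [f2], whose integral vanishes because [m] is the mean of [X]. The sign of [f2]
    varies, so this is where true integrability is required. *)
Lemma mean_le_affine (X : Omega -> V) (m k : V) (a s : R) :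
  measurable_fun setT (X : Omega -> borel) ->
  (forall j, 'E_P[fun w => (X w 0 j)%R] = (m 0 j)%:E)%E ->
  mean_le (fun w => enorm (X w - m) ^+ 2) s ->
  mean_le (fun w => enorm (k + a *: X w) ^+ 2)
    (enorm (k + a *: m) ^+ 2 + a ^+ 2 * s).
Proof.
move=> mX EX Xs; set v := k + a *: m.
have [mf f0 fs] := Xs.
pose f1 w := enorm v ^+ 2 + a ^+ 2 * enorm (X w - m) ^+ 2.
have f1le : mean_le f1 (enorm v ^+ 2 + a ^+ 2 * s).
  apply: mean_leD; first exact: mean_le_cst (sqr_ge0 _).
  exact: mean_leZ (sqr_ge0 _) Xs.
pose f2 w := \sum_(j < d) (2 * a * v 0 j) * (X w 0 j - m 0 j).
have E w : enorm (k + a *: X w) ^+ 2 = f1 w + f2 w.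
  have -> : k + a *: X w = v + a *: (X w - m).
    by apply/rowP => j; rewrite !mxE; ring.
  rewrite enormD_sqr enormZ_sqr /f1 /f2 dotZr addrAC; congr (_ + _).
  rewrite mulrA mulr_sumr; apply: eq_bigr => j _; rewrite !mxE; ring.
have ij (j : 'I_d) : P.-integrable setT
    (EFin \o (fun w => (2 * a * v 0 j) * (X w 0 j - m 0 j))).
  have := integrable_coord j mX Xs => iX.
  have := integrableB measurableT iX (finite_measure_integrable_cst P (m 0 j) measurableT).
  by move=> /(integrableZl measurableT (2 * a * v 0 j)).
have f2E : EFin \o f2 = (fun w =>
    \sum_(j < d) ((2 * a * v 0 j) * (X w 0 j - m 0 j))%:E)%E.
  by apply/funext => w /=; rewrite /f2 sumEFin.
have i2 : P.-integrable setT (EFin \o f2).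
  by rewrite f2E; apply: integrable_sum => // j _; exact: ij.
have E2 : (\int[P]_w (f2 w)%:E = 0)%E.
  transitivity (\int[P]_w (EFin \o f2) w)%E => //.
  rewrite f2E integral_sum//= big1// => j _.
  under eq_integral do rewrite EFinM EFinB.
  have iX := integrable_coord j mX Xs.
  have ic := finite_measure_integrable_cst P (m 0 j) measurableT.
  rewrite integralZl//; last by apply: integrableB.
  rewrite integralB_EFin//.
  have := EX j; rewrite unlock => ->.
  have := expectation_cst P (m 0 j); rewrite unlock => ->.
  by rewrite subee// mule0.
have i1 : P.-integrable setT (EFin \o f1).
  have [m1 f10 f1s] := f1le.
  apply/integrableP; split; first exact/measurable_EFinP.
  under eq_integral do rewrite /= ger0_norm//.
  by apply: le_lt_trans f1s _; rewrite ltry.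
split; [|by move=> w; exact: sqr_ge0|].
  apply: measurable_enorm_sqr; apply: measurable_borelD => //.
  exact: measurable_borelZ.
under eq_integral do rewrite E EFinD.
have := integralD measurableT i1 i2 => /= ->.
by rewrite E2 adde0; have [] := f1le.
Qed.

(** With [X] frozen, the bound for [Y] replaces [Y] by [mY] and adds its variance term; the bound
    for [X] with offset [k + b *: mY] then does the same. Both hypotheses hold for every offset for
    this purpose. *)
Lemma mean_le_affine2 (X Y : Omega -> V) (mX mY k : V) (a b s t : R) :
  0 <= t ->
  measurable_fun setT (X : Omega -> borel) ->
  measurable_fun setT (Y : Omega -> borel) ->
  (forall A B : set borel, measurable A -> measurable B ->
    P (X @^-1` A `&` Y @^-1` B) = (P (X @^-1` A) * P (Y @^-1` B))%E) ->
  (forall v, mean_le (fun w => enorm (v + a *: X w) ^+ 2)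
    (enorm (v + a *: mX) ^+ 2 + a ^+ 2 * s)) ->
  (forall v, mean_le (fun w => enorm (v + b *: Y w) ^+ 2)
    (enorm (v + b *: mY) ^+ 2 + b ^+ 2 * t)) ->
  mean_le (fun w => enorm (k + a *: X w + b *: Y w) ^+ 2)
    (enorm (k + a *: mX + b *: mY) ^+ 2 + a ^+ 2 * s + b ^+ 2 * t).
Proof.
move=> t0 meX meY XY hX hY.
split; [|by move=> w; exact: sqr_ge0|].
  apply: measurable_enorm_sqr.
  by do 2?[apply: measurable_borelD] => //; exact: measurable_borelZ.
pose h (z : borel * borel) : \bar R :=
  (enorm (k + a *: z.1 + b *: z.2) ^+ 2)%:E.
pose g (x : borel) : \bar R :=
  (enorm (k + b *: mY + a *: x) ^+ 2 + b ^+ 2 * t)%:E.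
have mE dT (T : measurableType dT) (c : V) (Z : T -> V) :
    measurable_fun setT (Z : T -> borel) ->
    measurable_fun setT (fun w => enorm (c + Z w) ^+ 2).
  by move=> mZ; apply: measurable_enorm_sqr; exact: measurable_borelD.
apply: (@le_trans _ _ (\int[P]_w g (X w))%E); last first.
  have [_ _] := mean_leD (hX (k + b *: mY))
    (mean_le_cst (mulr_ge0 (sqr_ge0 b) t0)).
  by rewrite (addrAC k).
apply: (@le_integral_independent_pair _ _ _ P _ _ borel borel X Y h g) => //.
- apply/measurable_EFinP; under eq_fun do rewrite -addrA.
  apply: mE; apply: measurable_borelD; apply: measurable_borelZ.
    exact: measurable_fst.
  exact: measurable_snd.
- by move=> z; rewrite lee_fin sqr_ge0.
- apply/measurable_EFinP; apply: measurable_funD => //.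
  by apply: mE; apply: measurable_borelZ; exact: measurable_id.
- move=> x; have [_ _] := hY (k + a *: x).
  by rewrite (addrAC k).
Qed.

End mean_le.

(** * One communication round *)

Lemma sum_ord_const (R : realType) (n : nat) (c : R) :
  \sum_(i < n) c = n%:R * c.
Proof. by rewrite sumr_const card_ord mulr_natl. Qed.

Section contraction.
Context {R : realType} {d : nat}.
Local Notation V := 'rV[R]_d.

(** Jensen's inequality for the square, from the nonnegativity of each [enorm (v i - m) ^+ 2] with
    [m] the mean. *)
Lemma enorm_mean_sqr_le (n : nat) (v : 'I_n -> V) : (0 < n)%N ->
  n%:R * enorm (n%:R^-1 *: \sum_(i < n) v i) ^+ 2 <= \sum_(i < n) enorm (v i) ^+ 2.
Proof.
move=> n0; set m := n%:R^-1 *: _.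
have nR : (0 : R) < n%:R by rewrite ltr0n.
have sm : \sum_(i < n) v i = n%:R *: m.
  by rewrite /m scalerA mulfV ?scale1r// gt_eqF.
have h (i : 'I_n) : 2 * dot (v i) m - enorm m ^+ 2 <= enorm (v i) ^+ 2.
  by have := sqr_ge0 (enorm (v i - m)); rewrite enormB_sqr; lra.
apply: (@le_trans _ _ (\sum_(i < n) (2 * dot (v i) m - enorm m ^+ 2))); last first.
  by apply: ler_sum => i _; exact: h.
rewrite sumrB sumr_const card_ord -mulr_sumr -dot_suml sm dotZl -enorm_sqr.
by rewrite -[enorm m ^+ 2 *+ n]mulr_natl; lra.
Qed.

Lemma affine_mean (n : nat) (k : V) (a : R) (u : 'I_n -> V) : (0 < n)%N ->
  k + a *: (n%:R^-1 *: \sum_(i < n) u i)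
  = n%:R^-1 *: \sum_(i < n) (k + a *: u i).
Proof.
move=> n0; have nR : (n%:R : R) != 0 by rewrite pnatr_eq0 -lt0n.
rewrite big_split/= sumr_const card_ord -scaler_sumr scalerDr.
by rewrite -[k *+ n]scaler_nat !scalerA mulVf// scale1r (mulrC a).
Qed.

(** One worker's share of a communication round. With [p = A - S] and [s = S - Y], the terms linear
    in [rho] add up to [- 2 * rho] times the sum of the squares of [p] and [s]. The quadratic terms,
    after bounding the squares of [p + s] and [p - s], are at most [rho ^+ 2 * (2 + oav + 2 * os)]
    times the same sum, which the choice of [rho] turns into [rho] times it: half of the gain
    survives. *)
Lemma round_contraction (rho os oav : R) (A S Y : V) :
  0 <= os -> 0 <= oav -> rho * (2 + oav + 2 * os) = 1 ->
  enorm (A - rho *: (A - S)) ^+ 2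
  + 2 * enorm (S + (rho / 2) *: ((A - S) - (S - Y))) ^+ 2
  + enorm (Y + rho *: (S - Y)) ^+ 2
  + 2 * rho ^+ 2 * os * enorm (S - Y) ^+ 2
  + rho ^+ 2 * oav / 2 * enorm (A - Y) ^+ 2
  <= enorm A ^+ 2 + 2 * enorm S ^+ 2 + enorm Y ^+ 2
     - rho * (enorm (A - S) ^+ 2 + enorm (S - Y) ^+ 2).
Proof.
move=> os0 oav0 rhoE.
have -> : A - Y = (A - S) + (S - Y) by rewrite addrA subrK.
have [p pE] : exists p, p = A - S by exists (A - S).
have [s sE] : exists s, s = S - Y by exists (S - Y).
rewrite -pE -sE.
have hp : dot A p - dot S p = enorm p ^+ 2 by rewrite -dotBl -pE enorm_sqr.
have hs : dot S s - dot Y s = enorm s ^+ 2 by rewrite -dotBl -sE enorm_sqr.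
have h0 : 0 <= rho ^+ 2 * os * enorm p ^+ 2 
  by have r2 := sqr_ge0 rho; have p2 := sqr_ge0 (enorm p);
  rewrite mulr_ge0// mulr_ge0.
have h1 := enormD_sqr_le p s.
have h2 := enormD_sqr_le p (- s); rewrite enormN in h2.
have e1 : enorm (A - rho *: p) ^+ 2
    = enorm A ^+ 2 - 2 * rho * dot A p + rho ^+ 2 * enorm p ^+ 2.
  by rewrite enormB_sqr enormZ_sqr dotZr mulrA.
have e2 : enorm (S + (rho / 2) *: (p - s)) ^+ 2
    = enorm S ^+ 2 + rho * (dot S p - dot S s)
      + rho ^+ 2 / 4 * enorm (p - s) ^+ 2.
  by rewrite enormD_sqr enormZ_sqr dotZr dotBr; field.
have e3 : enorm (Y + rho *: s) ^+ 2
    = enorm Y ^+ 2 + 2 * rho * dot Y s + rho ^+ 2 * enorm s ^+ 2.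
  by rewrite enormD_sqr enormZ_sqr dotZr mulrA.
rewrite e1 e2 e3 {e1 e2 e3 pE sE}.
move: hp hs h0 h1 h2.
move: (enorm (p + s) ^+ 2) (enorm (p - s) ^+ 2) (enorm p ^+ 2) (enorm s ^+ 2).
move: (dot A p) (dot S p) (dot S s) (dot Y s) (enorm A ^+ 2) (enorm S ^+ 2).
move: (enorm Y ^+ 2) => nY Ap Sp Ss Ys nA nS a b P Q hp hs h0 h1 h2.
have h3 : rho ^+ 2 * (2 + oav + 2 * os) = rho.
  by rewrite expr2 -mulrA rhoE mulr1.
have h4 : rho ^+ 2 * oav / 2 * a <= rho ^+ 2 * oav / 2 * (2 * P + 2 * Q).
  by rewrite ler_wpM2l// divr_ge0// mulr_ge0// sqr_ge0.
have h5 : rho ^+ 2 / 2 * b <= rho ^+ 2 / 2 * (2 * P + 2 * Q).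
  by rewrite ler_wpM2l// divr_ge0// sqr_ge0.
have h6 : rho ^+ 2 * (2 + oav + 2 * os) * (P + Q) = rho * (P + Q) by rewrite h3.
have h7 : rho * (Ap - Sp) = rho * P by rewrite hp.
have h8 : rho * (Ss - Ys) = rho * Q by rewrite hs.
lra.
Qed.

End contraction.

Section communication_round.
Context {R : realType} {d n : nat}.
Local Notation V := 'rV[R]_d.
Context {dO : measure_display} {Omega : measurableType dO}.
Variable P : probability Omega R.
Hypothesis n0 : (0 < n)%N.
Variables (omega omegas omegaav rho : R).
Hypotheses (omega0 : 0 <= omega) (omegas0 : 0 <= omegas).
Hypotheses (omegaav0 : 0 <= omegaav) (rhoE : rho * (2 + omegaav + 2 * omegas) = 1).
Variables (C : 'I_n -> Omega -> V -> V) (Cs : Omega -> V -> V).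
Hypothesis server_moment : forall (x k : V) (a : R),
  mean_le P (fun w => enorm (k + a *: Cs w x) ^+ 2)
    (enorm (k + a *: x) ^+ 2 + a ^+ 2 * (omegas * enorm x ^+ 2)).
Hypothesis average_moment : forall (x : 'I_n -> V) (k : V) (a : R),
  mean_le P
    (fun w => enorm (k + a *: (n%:R^-1 *: \sum_(i < n) C i w (x i))) ^+ 2)
    (enorm (k + a *: (n%:R^-1 *: \sum_(i < n) x i)) ^+ 2
     + a ^+ 2 * (omegaav / n%:R * \sum_(i < n) enorm (x i) ^+ 2)).
Hypothesis joint_moment : forall (i : 'I_n) (x y k : V) (a b : R),
  mean_le P (fun w => enorm (k + a *: C i w x + b *: Cs w y) ^+ 2)
    (enorm (k + a *: x + b *: y) ^+ 2 + a ^+ 2 * (omega * enorm x ^+ 2)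
     + b ^+ 2 * (omegas * enorm y ^+ 2)).

Definition dispersion (hx : 'I_n -> V) (hs hy : V) : R :=
  \sum_(i < n) enorm (hx i - hs) ^+ 2 + n%:R * enorm (hs - hy) ^+ 2.

Definition primal_energy (x : 'I_n -> V) (xs y k : V) : R :=
  \sum_(i < n) enorm (x i - k) ^+ 2 + 2 * n%:R * enorm (xs - k) ^+ 2
  + n%:R * enorm (y - k) ^+ 2.

(** Every update is affine in the compressed vectors, so the moment bounds yield the energy of the
    mean update plus noise. Jensen splits the mean server update over the workers, which reduces the
    claim to [round_contraction]. The server noise enters the [n] worker updates and [y], hence its
    coefficient [2 * rho ^+ 2 * omegas]; the averaged worker noise has weight [2 * n%:R * (rho / 2)
    ^+ 2 * (omegaav / n%:R)]. The point [k] stays free for two uses, at [xstar] and at [hs]. *)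
Lemma round_primal (hx : 'I_n -> V) (hs hy k : V) :
  mean_le P (fun w => primal_energy
    (fun i => (1 - rho) *: hx i + rho *: (Cs w (hs - hy) + hy))
    ((1 - (rho + rho) / 2) *: hs + ((rho + rho) / 2) *: hy
      + (rho / 2) *: (n%:R^-1 *: \sum_(i < n) C i w (hx i - hy)))
    (hy + rho *: Cs w (hs - hy)) k)
  (primal_energy hx hs hy k - rho * dispersion hx hs hy).
Proof.
have nR : (0 : R) < n%:R by rewrite ltr0n.
have hhalf : (rho + rho) / 2 = rho by field.
have n0' : (0 : R) <= n%:R by exact: ltW.
have n20 : (0 : R) <= 2 * n%:R by rewrite mulr_ge0.
have H1 := mean_leD (mean_leD (mean_le_sum (index_enum 'I_n)
  (fun i => server_moment (hs - hy)
   ((1 - rho) *: hx i + rho *: hy - k) rho))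
   (mean_leZ n20 (average_moment (fun i => hx i - hy)
      ((1 - rho) *: hs + rho *: hy - k) (rho / 2))))
   (mean_leZ n0' (server_moment (hs - hy) (hy - k) rho)).
apply: (eq_mean_le (f := _)) (mean_leW _ H1).
  move=> w; rewrite /primal_energy hhalf.
  congr (_ + _ * _ + _ * _); first apply: eq_bigr => i _;
    congr (enorm _ ^+ 2); apply/rowP => j; rewrite !mxE; ring.
rewrite /primal_energy /dispersion.
have J : 2 * n%:R * enorm ((1 - rho) *: hs + rho *: hy - k
    + (rho / 2) *: (n%:R^-1 *: (\sum_(i < n) (hx i - hy)))) ^+ 2
  <= 2 * \sum_(i < n)
    enorm ((hs - k) + (rho / 2) *: ((hx i - hs) - (hs - hy))) ^+ 2.
  rewrite -mulrA ler_pM2l// affine_mean//.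
  under [in X in X <= _]eq_bigr => i _.
    have -> : (1 - rho) *: hs + rho *: hy - k + (rho / 2) *: (hx i - hy)
      = (hs - k) + (rho / 2) *: ((hx i - hs) - (hs - hy)).
      by apply/rowP => j; rewrite !mxE; field.
    over.
  exact: enorm_mean_sqr_le.
have K (i : 'I_n) :
    enorm ((1 - rho) *: hx i + rho *: hy - k + rho *: (hs - hy)) ^+ 2
    + 2 * enorm ((hs - k) + (rho / 2) *: ((hx i - hs) - (hs - hy))) ^+ 2
    + enorm (hy - k + rho *: (hs - hy)) ^+ 2
    + 2 * rho ^+ 2 * omegas * enorm (hs - hy) ^+ 2
    + rho ^+ 2 * omegaav / 2 * enorm (hx i - hy) ^+ 2
    <= enorm (hx i - k) ^+ 2 + 2 * enorm (hs - k) ^+ 2 + enorm (hy - k) ^+ 2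
     - rho * (enorm (hx i - hs) ^+ 2 + enorm (hs - hy) ^+ 2).
  have := round_contraction (hx i - k) (hs - k) (hy - k) omegas0 omegaav0 rhoE.
  have e (u v : V) : (u - k) - (v - k) = u - v by rewrite opprB addrA subrK.
  rewrite !e.
  have -> // : hx i - k - rho *: (hx i - hs)
      = (1 - rho) *: hx i + rho *: hy - k + rho *: (hs - hy).
  by apply/rowP => j; rewrite !mxE; ring.
have {}K := ler_sum (index_enum 'I_n) (P := xpredT) (fun i _ => K i).
rewrite sumrB -[X in _ <= _ - X]mulr_sumr !big_split/= !sum_ord_const -!mulr_sumr in K.
rewrite big_split/= sum_ord_const.
have E : 2 * n%:R * ((rho / 2) ^+ 2 * (omegaav / n%:R *
     \sum_(i < n) enorm (hx i - hy) ^+ 2)) =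
   rho ^+ 2 * omegaav / 2 * \sum_(i < n) enorm (hx i - hy) ^+ 2.
  by field; rewrite gt_eqF.
rewrite [2 * n%:R * (_ + _)]mulrDr E {E}.
move: J K.
move: (\sum_(i < n) enorm (hx i - hy) ^+ 2) => S1.
move: (\sum_(i < n) enorm (hx i - hs) ^+ 2) => S2.
move: (\sum_(i < n) enorm (hx i - k) ^+ 2) => S3.
move: (\sum_(i < n) enorm (hs - k + _) ^+ 2) => S4.
move: (\sum_(i < n) enorm (_ *: hx i + _ - _ + _) ^+ 2) => S5.
move: (enorm (_ *: hs + _ - _ + _) ^+ 2) => S6.
move: (enorm (hs - hy) ^+ 2) (enorm (hs - k) ^+ 2) => S7 S8.
move: (enorm (hy - k) ^+ 2) (enorm (hy - k + _) ^+ 2) => S9 S10.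
move=> J K; lra.
Qed.

(** The mean of [c_i - c_s] is [hx i - hs], which gives the cross term. The factor
    [1 + 2 * omega + 2 * omegas] is the exact count for the square of [hs - hy]:
    [2 * omega + omegas] from each worker, after splitting [hx i - hy] through [hs], and
    [1 + omegas] from the update of [vy]. For [hx i - hs] the count [1 + 2 * omega] is enlarged to
    match. *)
Lemma round_dual (hx : 'I_n -> V) (hs hy : V) (v : 'I_n -> V) (vy : V) (tau : R) :
  mean_le P (fun w =>
    \sum_(i < n) enorm (v i - tau *: (C i w (hx i - hy) - Cs w (hs - hy))) ^+ 2
    + n%:R * enorm (vy + tau *: Cs w (hs - hy)) ^+ 2)
  (\sum_(i < n) enorm (v i) ^+ 2 + n%:R * enorm vy ^+ 2
   - 2 * tau * (\sum_(i < n) dot (v i) (hx i - hs) - n%:R * dot vy (hs - hy))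
   + tau ^+ 2 * (1 + 2 * omega + 2 * omegas) * dispersion hx hs hy).
Proof.
have n0' : (0 : R) <= n%:R by exact: ler0n.
have H1 := mean_leD (mean_le_sum (index_enum 'I_n)
  (fun i => joint_moment i (hx i - hy) (hs - hy)
   (v i) (- tau) tau))
   (mean_leZ n0' (server_moment (hs - hy) vy tau)).
apply: (eq_mean_le (f := _)) (mean_leW _ H1).
  move=> w; congr (_ + _); apply: eq_bigr => i _.
  by congr (enorm _ ^+ 2); apply/rowP => j; rewrite !mxE; ring.
rewrite /dispersion.
have K (i : 'I_n) : enorm (v i + - tau *: (hx i - hy) + tau *: (hs - hy)) ^+ 2 +
   (- tau) ^+ 2 * (omega * enorm (hx i - hy) ^+ 2) +
   tau ^+ 2 * (omegas * enorm (hs - hy) ^+ 2) <=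
   enorm (v i) ^+ 2 - 2 * tau * dot (v i) (hx i - hs)
   + tau ^+ 2 * ((1 + 2 * omega + 2 * omegas) * enorm (hx i - hs) ^+ 2 +
      (2 * omega + omegas) * enorm (hs - hy) ^+ 2).
  have -> : v i + - tau *: (hx i - hy) + tau *: (hs - hy)
    = v i - tau *: (hx i - hs) by apply/rowP => j; rewrite !mxE; ring.
  have -> : hx i - hy = (hx i - hs) + (hs - hy) by rewrite addrA subrK.
  have h1 := enormD_sqr_le (hx i - hs) (hs - hy).
  have h2 : 0 <= tau ^+ 2 * omega by rewrite mulr_ge0// sqr_ge0.
  have h3 : 0 <= tau ^+ 2 * omegas * enorm (hx i - hs) ^+ 2.
    by have t2 := sqr_ge0 tau; have r2 := sqr_ge0 (enorm (hx i - hs));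
      rewrite mulr_ge0// mulr_ge0.
  have := ler_wpM2l h2 h1.
  have -> : enorm (v i - tau *: (hx i - hs)) ^+ 2 = enorm (v i) ^+ 2
      - 2 * tau * dot (v i) (hx i - hs) + tau ^+ 2 * enorm (hx i - hs) ^+ 2.
    by rewrite [LHS]enormB_sqr dotZr enormZ_sqr mulrA.
  move: h3; move: (enorm (hx i - hs + (hs - hy)) ^+ 2) (enorm _ ^+ 2) (enorm (hs - hy) ^+ 2).
  move: (dot _ _) (enorm _ ^+ 2) => *; lra.
have {}K := ler_sum (index_enum 'I_n) (P := xpredT) (fun i _ => K i).
have vyE : enorm (vy + tau *: (hs - hy)) ^+ 2 = enorm vy ^+ 2
   + 2 * tau * dot vy (hs - hy) + tau ^+ 2 * enorm (hs - hy) ^+ 2.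
  by rewrite enormD_sqr dotZr enormZ_sqr mulrA.
rewrite vyE.
rewrite !big_split/= sumrN !sum_ord_const -!mulr_sumr !big_split/= !sum_ord_const -!mulr_sumr in K.
rewrite !big_split/= !sum_ord_const.
rewrite -!mulr_sumr sqrrN in K *.
clear H1 vyE; move: K.
move: (\sum_(i < n) enorm (hx i - hy) ^+ 2) => S1.
move: (\sum_(i < n) enorm (hx i - hs) ^+ 2) => S2.
move: (\sum_(i < n) enorm (v i) ^+ 2) => S3.
move: (\sum_(i < n) enorm (v i + _ + _) ^+ 2) => S4.
move: (\sum_(i < n) dot (v i) (hx i - hs)) => S5.
move: (enorm (hs - hy) ^+ 2) (enorm vy ^+ 2) (dot vy (hs - hy)) => S6 S7 S8.
move: (n%:R) => N K.
have -> : tau ^+ 2 * (omegas * S6) = tau ^+ 2 * omegas * S6 by rewrite mulrA.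
lra.
Qed.

End communication_round.

(** * One step from a fixed state *)

Section coin.
Context {R : realType} {dO : measure_display} {Omega : measurableType dO}.
Variable P : probability Omega R.

(** The pair made of the coin and of the sample point seen through [K] is independent, so [A] can be
    averaged with the coin frozen. The other outcome is a constant: without communication the step
    from a fixed state is deterministic. *)
Lemma mean_le_coin (K : set_system Omega) (theta : Omega -> bool) (q : R)
    (A : Omega -> R) (a b : R) :
  sigma_algebra setT K -> K `<=` measurable ->
  measurable_fun setT theta -> P (theta @^-1` [set true]) = q%:E ->
  independent P (sigma_of theta) K ->
  measurable_fun [set: g_sigma_algebraType K] (A : g_sigma_algebraType K -> R) ->
  mean_le P A a -> 0 <= b ->
  mean_le P (fun w => if theta w then A w else b) (q * a + (1 - q) * b).
Proof.
move=> sK Km mth Pth ind mA [mA' A0 Aa] b0.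
have a0 : 0 <= a.
  rewrite -lee_fin; apply: le_trans Aa; apply: integral_ge0 => w _.
  by rewrite lee_fin.
have mT : measurable (theta @^-1` [set true]).
  by rewrite -[X in measurable X]setTI; exact: mth.
have q1 : mean_le P (fun w => if theta w then 1 else 0) q.
  split=> [|w|]; [exact: measurable_fun_ifT|by case: ifP|].
  have -> : (fun w => (if theta w then 1 else 0)%:E) =
      (fun w => (\1_(theta @^-1` [set true]) w)%:E) :> (Omega -> \bar R).
    apply/funext => w; rewrite indicE; case E : (theta w).
      by rewrite mem_set.
    by rewrite memNset//= E.
  have h := expectation_indic P mT; rewrite unlock in h.
  rewrite [leLHS](_ : _ = q%:E)//; apply: eq_trans h _; exact: Pth.
have q2 : mean_le P (fun w => if theta w then 0 else 1) (1 - q).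
  split=> [|w|]; [exact: measurable_fun_ifT|by case: ifP|].
  have -> : (fun w => (if theta w then 0 else 1)%:E) =
      (fun w => (\1_(~` (theta @^-1` [set true])) w)%:E) :> (Omega -> \bar R).
    apply/funext => w; rewrite indicE in_setC; case E : (theta w).
      by rewrite mem_set.
    by rewrite memNset//= E.
  have h := expectation_indic P (measurableC mT); rewrite unlock in h.
  rewrite [leLHS](_ : _ = (1 - q)%:E)//; apply: eq_trans h _.
  apply: eq_trans (probability_setC P mT) _.
  by rewrite EFinB; congr (_ - _)%E; exact: Pth.
have [_ _ H] := mean_leD (mean_leZ a0 q1) (mean_leZ b0 q2).
split; last 2 first.
- by move=> w; case: ifP.
- pose h (z : bool * g_sigma_algebraType K) : \bar R :=
    (if z.1 then A z.2 else b)%:E.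
  pose g (x : bool) : \bar R := (if x then a else b)%:E.
  apply: (@le_trans _ _ (\int[P]_w g (theta w))%E); last first.
    rewrite mulrC (mulrC _ b); apply: le_trans H; rewrite le_eqVlt; apply/orP; left.
    apply/eqP/eq_integral => w _; rewrite /g; case: (theta w) => /=;
    by rewrite mulr1 mulr0 ?addr0 ?add0r.
  apply: (@le_integral_independent_pair _ _ _ P _ _ bool (g_sigma_algebraType K)
    theta id h g) => //.
  + move=> _ B; rewrite setTI preimage_id => mB; apply: Km.
    by rewrite -(sigma_algebra_id sK).
  + move=> B D mB mD; apply: ind; last by rewrite -(sigma_algebra_id sK).
    by exists B => //; rewrite setTI.
  + apply/measurable_EFinP; apply: measurable_fun_ifT => //.
    exact: measurableT_comp mA measurable_snd.
  + by move=> [[] w]; rewrite lee_fin.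
  + move=> [] //=; rewrite /h /g/=.
    by have [_ _ ] := mean_le_cst P b0.
- by apply: measurable_fun_ifT.
Qed.

End coin.

(** * Energy balance of the local steps *)

Lemma energy_balance (R : realType) (gamma N : R)
    (a1 a2 a3 a4 a5 a6 a7 a8 a9 a10 a11 a12 a13 a14 : R) :
  a5 <= a1 - 2 * gamma * a2 + 2 * gamma * a3 - gamma ^+ 2 * a4 ->
  2 * N * a13 <= 2 * N * (a6 - 2 * gamma * a8 + 2 * gamma * a10) ->
  N * a14 <= N * (a7 - 2 * gamma * a9 + 2 * gamma * a11 - gamma ^+ 2 * a12) ->
  a5 + 2 * N * a13 + N * a14 <= a1 + 2 * N * a6 + N * a7
    - 2 * gamma * (a2 + 2 * N * a8 + N * a9)
    + 2 * gamma * (a3 + 2 * N * a10 + N * a11) - gamma ^+ 2 * (a4 + N * a12).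
Proof. move=> h1 h2 h3; lra. Qed.

(** After division by [gamma], the surplus [gamma ^+ 2 * v] becomes [gamma * v], exactly what is
    needed to raise the dual weight from [W] to [W']. *)
Lemma energy_balance_scaled (R : realType) (gamma W W' p' p s x v : R) :
  0 < gamma -> 0 <= v -> W' - gamma <= W ->
  p' <= p - 2 * gamma * s + 2 * gamma * x - gamma ^+ 2 * v ->
  gamma^-1 * p' + W' * v - 2 * x <= gamma^-1 * p + W * v - 2 * s.
Proof.
move=> g0 v0 WW h.
have h1 : gamma^-1 * p' <=
    gamma^-1 * (p - 2 * gamma * s + 2 * gamma * x - gamma ^+ 2 * v).
  by rewrite ler_pM2l// invr_gt0.
have E : gamma^-1 * (p - 2 * gamma * s + 2 * gamma * x - gamma ^+ 2 * v)
  = gamma^-1 * p - 2 * s + 2 * x - gamma * v by field; rewrite gt_eqF.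
have h2 := ler_wpM2r v0 WW.
rewrite E in h1; lra.
Qed.

Section one_step.
Context {R : realType} {d n : nat}.
Local Notation V := 'rV[R]_d.
Variables (gamma : R) (f : 'I_n -> V -> R) (fs g : V -> R) (xstar : V).

(** The initialization constraint multiplied by [n], which matches the weights of the energies. *)
Definition conserved (z : state R n d) : Prop :=
  \sum_(i < n) uw z i + (2 * n%:R) *: us z + n%:R *: uy z = 0.

Definition state_bregman (z : state R n d) : R :=
  \sum_(i < n) bregman (f i) (xw z i) xstar
  + 2 * n%:R * bregman fs (xs z) xstar + n%:R * bregman g (yv z) xstar.

Definition dual_energy (z : state R n d) : R :=
  \sum_(i < n) enorm (uw z i - grad (f i) xstar) ^+ 2
  + n%:R * enorm (uy z - grad g xstar) ^+ 2.

Definition lyapunov (W : R) (z : state R n d) : R :=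
  gamma^-1 * primal_energy (xw z) (xs z) (yv z) xstar + W * dual_energy z.

Let hw (z : state R n d) i := local_step gamma (f i) (xw z i) (uw z i).
Let hs (z : state R n d) := local_step gamma fs (xs z) (us z).
Let hy (z : state R n d) := local_step gamma g (yv z) (uy z).

Definition local_dispersion (z : state R n d) : R :=
  dispersion (hw z) (hs z) (hy z).

(** What remains of the pairing of all dual errors with the local iterates once [us] is eliminated;
    the same expression is the cross term of [round_dual]. *)
Definition dual_pairing (z : state R n d) : R :=
  \sum_(i < n) dot (uw z i - grad (f i) xstar) (hw z i - hs z)
  - n%:R * dot (uy z - grad g xstar) (hs z - hy z).

(** The gradient-step difference is [a - gamma *: v], where [a] is the error after the shifted step
    and [v] the dual error; solving its expanded square for the square of [a] produces the cross
    term and the negative [gamma ^+ 2] term. *)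
Lemma shifted_step_le (x u y gx gy : V) (D : R) :
  enorm ((x - gamma *: gx) - (y - gamma *: gy)) ^+ 2 <=
    enorm (x - y) ^+ 2 - 2 * gamma * D ->
  enorm ((x - gamma *: gx + gamma *: u) - y) ^+ 2 <=
  enorm (x - y) ^+ 2 - 2 * gamma * D
  + 2 * gamma * dot (u - gy) ((x - gamma *: gx + gamma *: u) - y)
  - gamma ^+ 2 * enorm (u - gy) ^+ 2.
Proof.
set a := (x - gamma *: gx + gamma *: u) - y; set v := u - gy.
have -> : (x - gamma *: gx) - (y - gamma *: gy) = a - gamma *: v.
  by rewrite /a /v; apply/rowP => j; rewrite !mxE; ring.
rewrite [X in X <= _ -> _]enormB_sqr enormZ_sqr dotZr (dotC v); lra.
Qed.

Lemma local_step_le L (h : V -> R) (x u : V) :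
  convex h -> smooth L h -> 0 < L -> 0 < gamma -> gamma <= L^-1 ->
  enorm (local_step gamma h x u - xstar) ^+ 2 <=
  enorm (x - xstar) ^+ 2 - 2 * gamma * bregman h x xstar
  + 2 * gamma * dot (u - grad h xstar) (local_step gamma h x u - xstar)
  - gamma ^+ 2 * enorm (u - grad h xstar) ^+ 2.
Proof.
move=> ch sh L0 g0 gL; apply: shifted_step_le.
exact: bregman_gradient_step x xstar ch sh L0 g0 gL.
Qed.

(** Subtract from the left side the conservation law paired with [S]: the contribution of [vs]
    disappears. *)
Lemma dual_pairing_eq (v : 'I_n -> V) (vs vy : V) (A : 'I_n -> V) (S Y : V) :
  \sum_(i < n) v i + (2 * n%:R) *: vs + n%:R *: vy = 0 ->
  \sum_(i < n) dot (v i) (A i) + 2 * n%:R * dot vs S + n%:R * dot vy Y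
  = \sum_(i < n) dot (v i) (A i - S) - n%:R * dot vy (S - Y).
Proof.
move=> /(congr1 (fun x => dot x S)).
rewrite !dotDl !dotZl dot0l dot_suml => E.
have -> : \sum_(i < n) dot (v i) (A i - S)
    = \sum_(i < n) dot (v i) (A i) - \sum_(i < n) dot (v i) S.
  by rewrite -sumrB; apply: eq_bigr => i _; rewrite dotBr.
rewrite dotBr; move: E.
move: (\sum_(i < n) dot (v i) S) (\sum_(i < n) dot (v i) (A i)).
by move: (dot vs S) (dot vy S) (dot vy Y) => a b c e h E; lra.
Qed.

Lemma local_steps_le L (W W' : R) (z : state R n d) :
  (forall i, convex (f i) /\ smooth L (f i)) ->
  convex fs /\ smooth L fs -> convex g /\ smooth L g ->
  0 < L -> 0 < gamma -> gamma <= L^-1 -> W' - gamma <= W ->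
  conserved z ->
  \sum_(i < n) grad (f i) xstar + (2 * n%:R) *: grad fs xstar
    + n%:R *: grad g xstar = 0 ->
  gamma^-1 * primal_energy (hw z) (hs z) (hy z) xstar + W' * dual_energy z
    - 2 * dual_pairing z
  <= lyapunov W z - 2 * state_bregman z.
Proof.
move=> cf [cfs sfs] [cg sg] L0 g0 gL WW cz opt.
have nR : (0 : R) <= n%:R by [].
have hwi := ler_sum (index_enum 'I_n) (P := xpredT) (fun i _ =>
  local_step_le (xw z i) (uw z i) (cf i).1 (cf i).2 L0 g0 gL).
have hsi := local_step_le (xs z) (us z) cfs sfs L0 g0 gL.
have hyi := ler_wpM2l nR (local_step_le (yv z) (uy z) cg sg L0 g0 gL).
have vs0 : 0 <= gamma ^+ 2 * enorm (us z - grad fs xstar) ^+ 2.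
  by apply: mulr_ge0; apply: sqr_ge0.
(* The surplus of the server step is given up here: [dual_energy] has no server term that it could
   pay for. *)
have {}hsi : enorm (hs z - xstar) ^+ 2 <= enorm (xs z - xstar) ^+ 2
    - 2 * gamma * bregman fs (xs z) xstar
    + 2 * gamma * dot (us z - grad fs xstar) (hs z - xstar).
  by apply: le_trans hsi _; rewrite gerBl.
have n20 : (0 : R) <= 2 * n%:R by rewrite mulr_ge0.
have {}hsi := ler_wpM2l n20 hsi.
rewrite sumrB !big_split/= sumrN -!mulr_sumr in hwi.
have := @dual_pairing_eq (fun i => uw z i - grad (f i) xstar)
  (us z - grad fs xstar) (uy z - grad g xstar)
  (fun i => hw z i - xstar) (hs z - xstar) (hy z - xstar).
have cz' : \sum_(i < n) (uw z i - grad (f i) xstar)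
    + (2 * n%:R) *: (us z - grad fs xstar) + n%:R *: (uy z - grad g xstar) = 0.
  have e (u v w u' v' w' : V) :
      (u - u') + (v - v') + (w - w') = (u + v + w) - (u' + v' + w').
    by apply/rowP => j; rewrite !mxE; ring.
  by rewrite sumrB !scalerBr e cz opt subr0.
move=> /(_ cz').
have e (u v : V) : (u - xstar) - (v - xstar) = u - v by rewrite opprB addrA subrK.
rewrite e; under [X in _ = X - _ -> _]eq_bigr do rewrite e.
rewrite -/(dual_pairing z) => X.
have D0 : 0 <= dual_energy z.
  by apply: addr_ge0; [apply: sumr_ge0 => i _|apply: mulr_ge0 => //]; exact: sqr_ge0.
have key : primal_energy (hw z) (hs z) (hy z) xstar <=
  primal_energy (xw z) (xs z) (yv z) xstar - 2 * gamma * state_bregman z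
  + 2 * gamma * dual_pairing z - gamma ^+ 2 * dual_energy z.
  rewrite -X; exact: energy_balance hwi hsi hyi.
exact: energy_balance_scaled g0 D0 WW key.
Qed.

End one_step.

(** * Moments of compressors and measurability of states *)

Section moments.
Context {R : realType} {d n : nat}.
Local Notation V := 'rV[R]_d.
Local Notation borel := (g_sigma_algebraType (@open V)).
Context {dO : measure_display} {Omega : measurableType dO}.
Variable P : probability Omega R.

Lemma random_map_comp (K : set_system Omega) (C : Omega -> V -> V)
    dT (T : measurableType dT) (phi : T -> Omega) (X : T -> V) :
  random_map K C -> measurable_fun setT (phi : T -> g_sigma_algebraType K) ->
  measurable_fun setT (X : T -> borel) ->
  measurable_fun setT ((fun w => C (phi w) (X w)) : T -> borel).
Proof.
move=> rC mphi mX.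
exact: measurableT_comp rC (measurable_fun_pair mphi mX).
Qed.

Lemma measurable_id_sub (G K : set_system Omega) :
  <<s K >> `<=` <<s G >> ->
  measurable_fun setT (id : g_sigma_algebraType G -> g_sigma_algebraType K).
Proof. by move=> KG _ B mB; rewrite setTI; exact: KG. Qed.

Lemma measurable_id_ambient (K : set_system Omega) :
  K `<=` measurable -> measurable_fun setT (id : Omega -> g_sigma_algebraType K).
Proof.
move=> Km _ B mB; rewrite setTI preimage_id.
exact: (smallest_sub (@sigma_algebra_measurable _ Omega) Km).
Qed.

Lemma measurable_random_map (K : set_system Omega) (C : Omega -> V -> V) (x : V) :
  K `<=` measurable -> random_map K C ->
  measurable_fun setT ((fun w => C w x) : Omega -> borel).
Proof.
move=> Km rC.
exact: (@random_map_comp K C _ Omega id (fun=> x) rC (measurable_id_ambient Km)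
  (@measurable_cst _ _ Omega borel setT x)).
Qed.

Lemma in_U_mean_le (K : set_system Omega) (C : Omega -> V -> V) (om : R) x :
  Defs.sub_sigma_algebra K -> random_map K C -> in_U P om C ->
  mean_le P (fun w => enorm (C w x - x) ^+ 2) (om * enorm x ^+ 2).
Proof.
move=> [sK Km] rC /(_ x)[_ Cx]; split=> [|w|]; last 2 first.
- exact: sqr_ge0.
- by rewrite unlock in Cx.
apply: measurable_enorm_sqr; apply: measurable_borelB => //.
exact: measurable_random_map Km rC.
Qed.

Lemma in_U_moment (K : set_system Omega) (C : Omega -> V -> V) (om : R) x k a :
  Defs.sub_sigma_algebra K -> random_map K C -> in_U P om C ->
  mean_le P (fun w => enorm (k + a *: C w x) ^+ 2)
    (enorm (k + a *: x) ^+ 2 + a ^+ 2 * (om * enorm x ^+ 2)).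
Proof.
move=> sK rC CU; apply: mean_le_affine.
- exact: measurable_random_map sK.2 rC.
- by have [] := CU x.
- exact: in_U_mean_le sK rC CU.
Qed.

Lemma in_U_joint_moment (K Ks : set_system Omega) (C Cs : Omega -> V -> V)
    (om oms : R) x y k a b :
  Defs.sub_sigma_algebra K -> Defs.sub_sigma_algebra Ks ->
  random_map K C -> random_map Ks Cs -> independent P K Ks -> 0 <= oms ->
  in_U P om C -> in_U P oms Cs ->
  mean_le P (fun w => enorm (k + a *: C w x + b *: Cs w y) ^+ 2)
    (enorm (k + a *: x + b *: y) ^+ 2 + a ^+ 2 * (om * enorm x ^+ 2)
     + b ^+ 2 * (oms * enorm y ^+ 2)).
Proof.
move=> sK sKs rC rCs ind oms0 CU CsU.
have pre (L : set_system Omega) (D : Omega -> V -> V) u (B : set borel) :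
    Defs.sub_sigma_algebra L -> random_map L D -> measurable B ->
    L ((fun w => D w u) @^-1` B).
  move=> [sL Lm] rD mB; rewrite -(sigma_algebra_id sL) -[X in <<s _ >> X]setTI.
  have mid : measurable_fun setT (id : g_sigma_algebraType L -> g_sigma_algebraType L).
    exact: measurable_id.
  exact: (@random_map_comp L D _ (g_sigma_algebraType L) id (fun=> u) rD mid
    (@measurable_cst _ _ (g_sigma_algebraType L) borel setT u)).
apply: mean_le_affine2.
- by rewrite mulr_ge0// sqr_ge0.
- exact: measurable_random_map sK.2 rC.
- exact: measurable_random_map sKs.2 rCs.
- move=> A B mA mB; apply: ind.
    exact: (pre K C x A sK rC mA).
  exact: (pre Ks Cs y B sKs rCs mB).
- by move=> v; exact: in_U_moment sK rC CU.
- by move=> v; exact: in_U_moment sKs rCs CsU.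
Qed.

(** The workers may be dependent: the mean follows by linearity, and the variance bound is the
    averaged compressor assumption itself. *)
Lemma in_U_average_moment (K : set_system Omega) (C : 'I_n -> Omega -> V -> V)
    (om oav : R) (x : 'I_n -> V) k a :
  Defs.sub_sigma_algebra K -> (forall i, random_map K (C i)) ->
  (forall i, in_U P om (C i)) ->
  ('E_P[fun w => (enorm (n%:R^-1 *: \sum_(i < n) (C i w (x i) - x i)) ^+ 2)%R]
    <= (oav / n%:R * \sum_(i < n) enorm (x i) ^+ 2)%:E)%E ->
  mean_le P
    (fun w => enorm (k + a *: (n%:R^-1 *: \sum_(i < n) C i w (x i))) ^+ 2)
    (enorm (k + a *: (n%:R^-1 *: \sum_(i < n) x i)) ^+ 2
     + a ^+ 2 * (oav / n%:R * \sum_(i < n) enorm (x i) ^+ 2)).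
Proof.
move=> sK rC CU av.
have mC i : measurable_fun setT ((fun w => C i w (x i)) : Omega -> borel).
  exact: measurable_random_map sK.2 (rC i).
have mS : measurable_fun setT
    ((fun w => n%:R^-1 *: \sum_(i < n) C i w (x i)) : Omega -> borel).
  by apply: measurable_borelZ; exact: measurable_borel_sum.
apply: mean_le_affine => //.
- move=> j.
  have iC i := integrable_coord j (mC i) (in_U_mean_le (x i) sK (rC i) (CU i)).
  have EC i := (CU i (x i)).1 j.
  rewrite unlock.
  under eq_integral do rewrite mxE summxE EFinM -sumEFin.
  rewrite integralZl//; last first.
    by apply: integrable_sum => // i _; exact: iC.
  rewrite integral_sum//.
  under eq_bigr => i _.
    have := EC i; rewrite unlock => ->; over.
  by rewrite sumEFin -EFinM mxE summxE.
- split=> [|w|]; last 2 first.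
  + exact: sqr_ge0.
  + rewrite unlock in av; apply: le_trans av.
    rewrite le_eqVlt; apply/orP; left; apply/eqP/eq_integral => w _.
    by rewrite -scalerBr -sumrB.
  by apply: measurable_enorm_sqr; apply: measurable_borelB.
Qed.

End moments.

(** * Measurability of states and of the energies *)

Section state_measurability.
Context {R : realType} {d n : nat}.
Local Notation V := 'rV[R]_d.
Local Notation borel := (g_sigma_algebraType (@open V)).
Variables (gamma eta rho : R) (f : 'I_n -> V -> R) (fs g : V -> R) (xstar : V).
Variable L : R.
Hypotheses (sf : forall i, smooth L (f i)) (sfs : smooth L fs) (sg : smooth L g).

(** The record [state] carries no sigma-algebra, so measurability is required of each component. *)
Definition measurable_state dT (T : measurableType dT) (z : T -> state R n d) :=
  [/\ forall i, measurable_fun setT ((fun w => xw (z w) i) : T -> borel),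
      measurable_fun setT ((fun w => xs (z w)) : T -> borel),
      measurable_fun setT ((fun w => yv (z w)) : T -> borel) &
      [/\ forall i, measurable_fun setT ((fun w => uw (z w) i) : T -> borel),
          measurable_fun setT ((fun w => us (z w)) : T -> borel) &
          measurable_fun setT ((fun w => uy (z w)) : T -> borel)]].

(** The source space is quantified because the same functional is read over the ambient space, over
    sub-sigma-algebras, and over the product of past and present. *)
Definition measurable_functional (Phi : state R n d -> R) :=
  forall dT (T : measurableType dT) (z : T -> state R n d),
    measurable_state z -> measurable_fun setT (fun w => Phi (z w)).

Lemma measurable_state_comp dT (T : measurableType dT) dU (U : measurableType dU)
    (phi : U -> T) (z : T -> state R n d) :
  measurable_fun setT phi -> measurable_state z ->
  measurable_state (fun w => z (phi w)).
Proof.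
move=> mphi [m1 m2 m3 [m4 m5 m6]]; split; [move=> i| | |split; [move=> i| |]].
- exact: measurableT_comp (m1 i) mphi.
- exact: measurableT_comp m2 mphi.
- exact: measurableT_comp m3 mphi.
- exact: measurableT_comp (m4 i) mphi.
- exact: measurableT_comp m5 mphi.
- exact: measurableT_comp m6 mphi.
Qed.

Lemma measurable_state_cst dT (T : measurableType dT) (z0 : state R n d) :
  measurable_state (fun _ : T => z0).
Proof. by split=> *; [..|split=> *]; exact: measurable_cst. Qed.

Lemma measurable_local_step dT (T : measurableType dT) (h : V -> R) (X U : T -> V) :
  smooth L h -> measurable_fun setT (X : T -> borel) ->
  measurable_fun setT (U : T -> borel) ->
  measurable_fun setT ((fun w => local_step gamma h (X w) (U w)) : T -> borel).
Proof.
move=> sh mX mU; rewrite /local_step; apply: measurable_borelD.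
  apply: measurable_borelB => //; apply: measurable_borelZ.
  exact: measurable_grad sh mX.
exact: measurable_borelZ.
Qed.

Lemma measurable_state_step dT (T : measurableType dT) (p : R) (th : T -> bool)
    (C : T -> 'I_n -> V -> V) (Cs : T -> V -> V) (z : T -> state R n d) :
  measurable_fun setT th ->
  (forall i (X : T -> V), measurable_fun setT (X : T -> borel) ->
    measurable_fun setT ((fun w => C w i (X w)) : T -> borel)) ->
  (forall X : T -> V, measurable_fun setT (X : T -> borel) ->
    measurable_fun setT ((fun w => Cs w (X w)) : T -> borel)) ->
  measurable_state z ->
  measurable_state (fun w => bicolor_step gamma eta eta rho rho f fs g p
    (th w) (C w) (Cs w) (z w)).
Proof.
move=> mth mC mCs [m1 m2 m3 [m4 m5 m6]].
have mx i := measurable_local_step (sf i) (m1 i) (m4 i).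
have ms := measurable_local_step sfs m2 m5.
have my := measurable_local_step sg m3 m6.
have mc i := mC i _ (measurable_borelB (mx i) my).
have mcs := mCs _ (measurable_borelB ms my).
have mcb := measurable_borelZ n%:R^-1 (measurable_borel_sum (index_enum 'I_n) mc).
have mif (X Y : T -> V) (Z : T -> V) :
    (forall w, Z w = if th w then X w else Y w) ->
    measurable_fun setT (X : T -> borel) -> measurable_fun setT (Y : T -> borel) ->
    measurable_fun setT (Z : T -> borel).
  by move=> /funext -> mX mY; exact: measurable_borel_if.
split; [move=> i| | |split; [move=> i| |]].
- apply: (mif _ _ _ _ _ (mx i)) => [w|]; first by rewrite /bicolor_step; case: (th w).
  exact: measurable_borelD (measurable_borelZ _ (mx i))
    (measurable_borelZ _ (measurable_borelD mcs my)).
- apply: (mif _ _ _ _ _ ms) => [w|]; first by rewrite /bicolor_step; case: (th w).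
  exact: measurable_borelD (measurable_borelD (measurable_borelZ _ ms)
    (measurable_borelZ _ my)) (measurable_borelZ _ mcb).
- apply: (mif _ _ _ _ _ my) => [w|]; first by rewrite /bicolor_step; case: (th w).
  exact: measurable_borelD my (measurable_borelZ _ mcs).
- apply: (mif _ _ _ _ _ (m4 i)) => [w|]; first by rewrite /bicolor_step; case: (th w).
  exact: measurable_borelB (m4 i) (measurable_borelZ _ (measurable_borelB (mc i) mcs)).
- apply: (mif _ _ _ _ _ m5) => [w|]; first by rewrite /bicolor_step; case: (th w).
  exact: measurable_borelB (measurable_borelD m5 (measurable_borelZ _ mcb))
    (measurable_borelZ _ mcs).
- apply: (mif _ _ _ _ _ m6) => [w|]; first by rewrite /bicolor_step; case: (th w).
  exact: measurable_borelD m6 (measurable_borelZ _ mcs).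
Qed.

Lemma measurable_primal_energy dT (T : measurableType dT)
    (x : T -> 'I_n -> V) (s y : T -> V) (k : V) :
  (forall i, measurable_fun setT ((fun w => x w i) : T -> borel)) ->
  measurable_fun setT (s : T -> borel) -> measurable_fun setT (y : T -> borel) ->
  measurable_fun setT (fun w => primal_energy (x w) (s w) (y w) k).
Proof.
move=> mx ms my; apply: measurable_funD; [apply: measurable_funD|].
- apply: measurable_sum => i; apply: measurable_enorm_sqr.
  by apply: measurable_borelB.
- apply: measurable_funM => //; apply: measurable_enorm_sqr.
  by apply: measurable_borelB.
- apply: measurable_funM => //; apply: measurable_enorm_sqr.
  by apply: measurable_borelB.
Qed.

Lemma measurable_dispersion dT (T : measurableType dT)
    (x : T -> 'I_n -> V) (s y : T -> V) :
  (forall i, measurable_fun setT ((fun w => x w i) : T -> borel)) ->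
  measurable_fun setT (s : T -> borel) -> measurable_fun setT (y : T -> borel) ->
  measurable_fun setT (fun w => dispersion (x w) (s w) (y w)).
Proof.
move=> mx ms my; apply: measurable_funD.
- apply: measurable_sum => i; apply: measurable_enorm_sqr.
  exact: measurable_borelB.
- apply: measurable_funM => //; apply: measurable_enorm_sqr.
  exact: measurable_borelB.
Qed.

Lemma measurable_lyapunov (W : R) :
  measurable_functional (lyapunov gamma f g xstar W).
Proof.
move=> dT T z [m1 m2 m3 [m4 m5 m6]].
apply: measurable_funD; apply: measurable_funM => //.
  exact: measurable_primal_energy.
apply: measurable_funD.
- apply: measurable_sum => i; apply: measurable_enorm_sqr.
  exact: measurable_borelB.
- apply: measurable_funM => //; apply: measurable_enorm_sqr.
  exact: measurable_borelB.
Qed.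

Lemma measurable_local_dispersion :
  measurable_functional (local_dispersion gamma f fs g).
Proof.
move=> dT T z [m1 m2 m3 [m4 m5 m6]].
have hi i := measurable_local_step (sf i) (m1 i) (m4 i).
exact: (measurable_dispersion hi (measurable_local_step sfs m2 m5)
  (measurable_local_step sg m3 m6)).
Qed.

Lemma measurable_state_bregman :
  measurable_functional (state_bregman f fs g xstar).
Proof.
move=> dT T z [m1 m2 m3 _].
have hi i := @measurable_bregman _ _ _ T L (f i) (fun w => xw (z w) i) xstar
  (sf i) (m1 i).
have hs := @measurable_bregman _ _ _ T L fs (fun w => xs (z w)) xstar sfs m2.
have hy := @measurable_bregman _ _ _ T L g (fun w => yv (z w)) xstar sg m3.
exact: (measurable_funD (measurable_funD (measurable_sum (index_enum 'I_n) hi)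
  (measurable_funM (measurable_cst _) hs)) (measurable_funM (measurable_cst _) hy)).
Qed.

End state_measurability.

(** * The random process *)

(** The cross term fixes the weight: a round occurs with probability [q] and moves the dual
    variables by [q * eta / gamma], so a coefficient of exactly [2 * X] forces the weight
    [gamma / (eta * q ^+ 2)]. With it the dual noise costs [q * eta * beta / gamma] per unit of [D],
    a fraction [c] of the primal gain. *)
Lemma round_balance (R : realType) (gamma eta rho q beta c PE V X D : R) :
  0 < gamma -> 0 < eta -> 0 < q -> eta * beta = c * rho ->
  q * (gamma^-1 * (PE - rho * D) + gamma / (eta * q ^+ 2) *
     (V - 2 * (q * eta / gamma) * X + (q * eta / gamma) ^+ 2 * beta * D))
  + (1 - q) * (gamma^-1 * PE + gamma / (eta * q ^+ 2) * V)
  = gamma^-1 * PE + gamma / (eta * q ^+ 2) * V - 2 * X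
    - q * ((1 - c) * rho / gamma) * D.
Proof.
move=> g0 e0 q0 E.
have -> : q * ((1 - c) * rho / gamma) * D
    = q * rho / gamma * D - q * (eta * beta) / gamma * D by rewrite E; field; rewrite gt_eqF.
by field; rewrite !gt_eqF.
Qed.

Section process.
Context {R : realType} {d n : nat}.
Local Notation V := 'rV[R]_d.
Local Notation borel := (g_sigma_algebraType (@open V)).
Context {dO : measure_display} {Omega : measurableType dO}.
Variable P : probability Omega R.
Hypothesis n0 : (0 < n)%N.
Variables (omega omegas omegaav : R).
Variables (F Fs : nat -> set_system Omega).
Variables (Cw : nat -> 'I_n -> Omega -> V -> V) (Cs : nat -> Omega -> V -> V).
Variable theta : nat -> {RV P >-> bool}.
Hypothesis ca : compressor_assumption omega omegas omegaav F Fs Cw Cs theta.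
Hypotheses (omega0 : 0 <= omega) (omegas0 : 0 <= omegas) (omegaav0 : 0 <= omegaav).
Variables (gamma eta rho c L : R) (f : 'I_n -> V -> R) (fs g : V -> R) (xstar : V).
Hypotheses (cf : forall i, convex (f i) /\ smooth L (f i)).
Hypotheses (cfs : convex fs /\ smooth L fs) (cg : convex g /\ smooth L g).
Hypotheses (L0 : 0 < L) (gamma0 : 0 < gamma) (gammaL : gamma <= L^-1).
Hypotheses (eta0 : 0 < eta) (rho0 : 0 < rho).
Hypothesis rhoE : rho * (2 + omegaav + 2 * omegas) = 1.
Hypothesis etaE : eta * (1 + 2 * omega + 2 * omegas) = c * rho.
Hypothesis stationary : \sum_(i < n) grad (f i) xstar
  + (2 * n%:R) *: grad fs xstar + n%:R *: grad g xstar = 0.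

Let sf i := (cf i).2.
Let sfs := cfs.2.
Let sg := cg.2.

Definition round_blocks (s : nat + nat) : set_system Omega :=
  match s with
  | inl t => <<s F t `|` Fs t >>
  | inr t => sigma_of (theta t)
  end.

Definition block_round (s : nat + nat) : nat :=
  match s with inl t => t | inr t => t end.

(** A generating class; rounds strictly before [t], compressors and coins alike, are what the state
    at time [t] depends on. *)
Definition past (t : nat) : set_system Omega :=
  \bigcup_(s in [set s | (block_round s < t)%N]) round_blocks s.

Definition present (t : nat) : set_system Omega :=
  \bigcup_(s in [set s | block_round s = t]) round_blocks s.

Lemma round_blocks_sigma s : sigma_algebra setT (round_blocks s).
Proof.
case: s => t; first exact: smallest_sigma_algebra.
exact: sigma_algebra_preimage (sigma_algebra_measurable _).
Qed.

Lemma round_blocks_measurable s : round_blocks s `<=` measurable.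
Proof.
case: s => t.
  apply: smallest_sub; first exact: sigma_algebra_measurable.
  move=> A [|]; first exact: (workers_sigma ca t).2.
  exact: (server_sigma ca t).2.
by move=> _ [B mB <-]; exact: (measurable_funP (theta t)).
Qed.

Lemma past_present_independent t :
  independent P <<s past t >> <<s present t >>.
Proof.
apply: mutually_independent_blocks.
- exact: round_blocks_sigma.
- exact: round_blocks_measurable.
- exact: rounds_coins_independent ca.
- by apply/seteqP; split=> s //= [] /[swap] ->; rewrite ltnn.
Qed.

Lemma coin_round_independent t :
  independent P (sigma_of (theta t)) (round_blocks (inl t)).
Proof.
move=> A B sA sB.
have := rounds_coins_independent ca (J := [:: inr t; inl t])
  (A := fun s => if s is inr _ then A else B).
rewrite !big_cons !big_nil !setIT !mule1; apply => //.
by move=> j; rewrite !inE => /orP[] /eqP ->.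
Qed.

Lemma worker_sub_block t : F t `<=` round_blocks (inl t).
Proof. by move=> A FA; apply: sub_sigma_algebra; left. Qed.

Lemma server_sub_block t : Fs t `<=` round_blocks (inl t).
Proof. by move=> A FA; apply: sub_sigma_algebra; right. Qed.

Lemma block_sub_past s t : (block_round s < t)%N -> round_blocks s `<=` <<s past t >>.
Proof. by move=> st A sA; apply: sub_sigma_algebra; exists s. Qed.

Lemma block_sub_present s : round_blocks s `<=` <<s present (block_round s) >>.
Proof. by move=> A sA; apply: sub_sigma_algebra; exists s. Qed.

Lemma past_sub s t : (s <= t)%N -> <<s past s >> `<=` <<s past t >>.
Proof.
move=> st; apply: sub_sigma_algebra2 => A [k ks kA]; exists k => //.
exact: leq_trans ks st.
Qed.

Lemma sigma_sub (K : set_system Omega) (G : set_system Omega) :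
  K `<=` <<s G >> -> <<s K >> `<=` <<s G >>.
Proof. by apply: smallest_sub; exact: smallest_sigma_algebra. Qed.

Lemma past_sub_algorithm t : <<s past t >> `<=` algorithm_sigma F Fs theta.
Proof.
apply: smallest_sub; first exact: smallest_sigma_algebra.
move=> A [[k|k] /= kt].
  move: A; apply: smallest_sub; first exact: smallest_sigma_algebra.
  move=> A kA; apply: sub_sigma_algebra; exists k => //; left.
  by case: kA; [left|right].
by move=> kA; apply: sub_sigma_algebra; exists k => //; right.
Qed.

Lemma algorithm_sigma_measurable : algorithm_sigma F Fs theta `<=` measurable.
Proof.
apply: smallest_sub; first exact: sigma_algebra_measurable.
move=> A [k _ [[kA|kA]|kA]].
- exact: (workers_sigma ca k).2.
- exact: (server_sigma ca k).2.
- exact: (@round_blocks_measurable (inr k)).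
Qed.

Lemma measurable_coin (G : set_system Omega) t : sigma_of (theta t) `<=` <<s G >> ->
  measurable_fun setT (theta t : g_sigma_algebraType G -> bool).
Proof. by move=> h _ B mB; apply: h; exists B. Qed.

(** Coin, compressor randomness and state have separate sources [th], [phi] and [z], so that the
    coin or the state can be frozen, or the state read from the past and the rest from the
    present. *)
Lemma measurable_step_on dT (T : measurableType dT) (t : nat) (q : R)
    (th : T -> bool) (phi : T -> Omega) (z : T -> state R n d) :
  measurable_fun setT th ->
  measurable_fun setT (phi : T -> g_sigma_algebraType (round_blocks (inl t))) ->
  measurable_state z ->
  measurable_state (fun w => bicolor_step gamma eta eta rho rho f fs g q
    (th w) (fun i => Cw t i (phi w)) (Cs t (phi w)) (z w)).
Proof.
move=> mth mphi mz.
have idF : measurable_fun setT (id : g_sigma_algebraType (round_blocks (inl t)) ->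
    g_sigma_algebraType (F t)).
  apply: measurable_id_sub; apply: sigma_sub => A FA.
  by apply: sub_sigma_algebra; exact: worker_sub_block.
have idFs : measurable_fun setT (id : g_sigma_algebraType (round_blocks (inl t)) ->
    g_sigma_algebraType (Fs t)).
  apply: measurable_id_sub; apply: sigma_sub => A FA.
  by apply: sub_sigma_algebra; exact: server_sub_block.
apply: (measurable_state_step _ _ _ sf sfs sg) => //.
- move=> i X mX; apply: random_map_comp mX; first exact: workers_random ca t i.
  exact: measurableT_comp idF mphi.
- move=> X mX; apply: random_map_comp mX; first exact: server_random ca t.
  exact: measurableT_comp idFs mphi.
Qed.

Variables (p : nat -> R) (z0 : state R n d).
Hypothesis coin : forall t, P (theta t @^-1` [set true]) = (p t.+1)%:E.
Let z := bicolor gamma eta eta rho rho f fs g p theta Cw Cs z0.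

(** Adaptedness, by induction: round [t] belongs to [past t.+1], and [past t] is contained in it. *)
Lemma measurable_process t :
  measurable_state (z t : g_sigma_algebraType (past t) -> state R n d).
Proof.
elim: t => [|t IH]; first exact: measurable_state_cst.
have h1 : measurable_fun setT
    (theta t : g_sigma_algebraType (past t.+1) -> bool).
  by apply: measurable_coin; exact: (@block_sub_past (inr t)).
have h2 : measurable_fun setT (id : g_sigma_algebraType (past t.+1) ->
    g_sigma_algebraType (round_blocks (inl t))).
  by apply: measurable_id_sub; apply: sigma_sub; exact: (@block_sub_past (inl t)).
have h3 : measurable_state (z t : g_sigma_algebraType (past t.+1) -> state R n d).
  have hid : measurable_fun setT (id : g_sigma_algebraType (past t.+1) ->
      g_sigma_algebraType (past t)).
    by apply: measurable_id_sub; exact: past_sub.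
  exact: (measurable_state_comp hid IH).
exact: (@measurable_step_on _ (g_sigma_algebraType (past t.+1)) t (p t.+1) _ id
  _ h1 h2 h3).
Qed.

Lemma measurable_process_ambient t : measurable_state (z t : Omega -> state R n d).
Proof.
have hid : measurable_fun setT (id : Omega -> g_sigma_algebraType (past t)).
  apply: measurable_id_ambient => A [s _ sA]; exact: round_blocks_measurable sA.
exact: (measurable_state_comp hid (measurable_process t)).
Qed.

(** Replaces conditioning on the past. The independent pair consists of two copies of the identity,
    into the sample space with the past and with the present sigma-algebra. The one-step bound is
    asked only at states reached by the process, where [conserved] is available. *)
Lemma random_step t (Phi Psi : state R n d -> R) :
  measurable_functional Phi -> measurable_functional Psi ->
  (forall s, 0 <= Phi s) ->
  (forall w, mean_le P (fun w' => Phi (bicolor_step gamma eta eta rho rho f fs g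
    (p t.+1) (theta t w') (fun i => Cw t i w') (Cs t w') (z t w))) (Psi (z t w))) ->
  (\int[P]_w (Phi (z t.+1 w))%:E <= \int[P]_w (Psi (z t w))%:E)%E.
Proof.
move=> mPhi mPsi Phi0 H.
pose T1 := g_sigma_algebraType (past t); pose T2 := g_sigma_algebraType (present t).
pose h (x : T1 * T2) : \bar R := (Phi (bicolor_step gamma eta eta rho rho f fs g
  (p t.+1) (theta t x.2) (fun i => Cw t i x.2) (Cs t x.2) (z t x.1)))%:E.
pose k (x : T1) : \bar R := (Psi (z t x))%:E.
have pm : past t `<=` measurable.
  by move=> A [s _ sA]; exact: round_blocks_measurable sA.
have qm : present t `<=` measurable.
  by move=> A [s _ sA]; exact: round_blocks_measurable sA.
apply: (@le_integral_independent_pair _ _ _ P _ _ T1 T2 id id h k).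
- exact: measurable_id_ambient.
- exact: measurable_id_ambient.
- by move=> A B mA mB; exact: (@past_present_independent t A B mA mB).
- apply/measurable_EFinP; apply: mPhi.
  have h1 : measurable_fun setT (fun x : T1 * T2 => theta t x.2).
    apply: (measurableT_comp _ measurable_snd).
    by apply: measurable_coin; exact: (@block_sub_present (inr t)).
  have h2 : measurable_fun setT ((fun x : T1 * T2 => x.2) : T1 * T2 ->
      g_sigma_algebraType (round_blocks (inl t))).
    have hid : measurable_fun setT
        (id : T2 -> g_sigma_algebraType (round_blocks (inl t))).
      by apply: measurable_id_sub; apply: sigma_sub;
        exact: (@block_sub_present (inl t)).
    exact: (measurableT_comp hid measurable_snd).
  have h3 := measurable_state_comp
    (@measurable_fst _ _ T1 T2) (measurable_process t).
  exact: (@measurable_step_on _ (T1 * T2)%type t (p t.+1) _ _ _ h1 h2 h3).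
- by move=> x; rewrite lee_fin.
- by apply/measurable_EFinP; apply: mPsi; exact: measurable_process.
- by move=> x; have [_ _] := H x.
Qed.

(** The branch without communication ignores the compressors, so the identity maps in its value are
    mere placeholders. *)
Lemma coin_step t (Phi : state R n d -> R) (a : R) (s : state R n d) :
  measurable_functional Phi -> (forall s, 0 <= Phi s) ->
  mean_le P (fun w => Phi (bicolor_step gamma eta eta rho rho f fs g (p t.+1)
    true (fun i => Cw t i w) (Cs t w) s)) a ->
  mean_le P (fun w => Phi (bicolor_step gamma eta eta rho rho f fs g (p t.+1)
    (theta t w) (fun i => Cw t i w) (Cs t w) s))
    (p t.+1 * a + (1 - p t.+1) * Phi (bicolor_step gamma eta eta rho rho f fs g
      (p t.+1) false (fun i => id) id s)).
Proof.
move=> mPhi Phi0 H.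
pose T := g_sigma_algebraType (round_blocks (inl t)).
have mA : measurable_fun setT ((fun w => Phi (bicolor_step gamma eta eta rho rho
    f fs g (p t.+1) true (fun i => Cw t i w) (Cs t w) s)) : T -> R).
  have h1 : measurable_fun setT ((fun=> true) : T -> bool).
    exact: measurable_cst.
  have h2 : measurable_fun setT (id : T -> T) by exact: measurable_id.
  have h3 := measurable_state_cst T s.
  by apply: mPhi; exact: (@measurable_step_on _ T t (p t.+1) _ _ _ h1 h2 h3).
have mth : measurable_fun setT (theta t) by exact: measurable_funP.
have := mean_le_coin (round_blocks_sigma (inl t))
  (@round_blocks_measurable (inl t)) mth (coin t) (@coin_round_independent t)
  mA H (Phi0 (bicolor_step gamma eta eta rho rho f fs g (p t.+1) false
    (fun i => id) id s)).
by apply: eq_mean_le => w; case: (theta t w).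
Qed.

Lemma server_moment t (x k : V) (a : R) :
  mean_le P (fun w => enorm (k + a *: Cs t w x) ^+ 2)
    (enorm (k + a *: x) ^+ 2 + a ^+ 2 * (omegas * enorm x ^+ 2)).
Proof.
apply: (in_U_moment (K := Fs t)).
- exact: server_sigma ca t.
- exact: server_random ca t.
- exact: server_in_U ca t.
Qed.

Lemma average_moment t (x : 'I_n -> V) (k : V) (a : R) :
  mean_le P
    (fun w => enorm (k + a *: (n%:R^-1 *: \sum_(i < n) Cw t i w (x i))) ^+ 2)
    (enorm (k + a *: (n%:R^-1 *: \sum_(i < n) x i)) ^+ 2
     + a ^+ 2 * (omegaav / n%:R * \sum_(i < n) enorm (x i) ^+ 2)).
Proof.
apply: (in_U_average_moment (K := F t) (om := omega)).
- exact: workers_sigma ca t.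
- by move=> i; exact: workers_random ca t i.
- by move=> i; exact: workers_in_U ca t i.
- exact: workers_average ca t x.
Qed.

Lemma joint_moment t (i : 'I_n) (x y k : V) (a b : R) :
  mean_le P (fun w => enorm (k + a *: Cw t i w x + b *: Cs t w y) ^+ 2)
    (enorm (k + a *: x + b *: y) ^+ 2 + a ^+ 2 * (omega * enorm x ^+ 2)
     + b ^+ 2 * (omegas * enorm y ^+ 2)).
Proof.
apply: (in_U_joint_moment (K := F t) (Ks := Fs t)) => //.
- exact: workers_sigma ca t.
- exact: server_sigma ca t.
- exact: workers_random ca t i.
- exact: server_random ca t.
- exact: workers_server_independent ca t.
- exact: workers_in_U ca t i.
- exact: server_in_U ca t.
Qed.

Lemma lyapunov_ge0 W s : 0 <= W -> 0 <= lyapunov gamma f g xstar W s.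
Proof.
move=> W0; have gi : 0 <= gamma^-1 by rewrite invr_ge0 ltW.
have sq (I : Type) (r : seq I) (v : I -> V) : 0 <= \sum_(i <- r) enorm (v i) ^+ 2.
  by apply: sumr_ge0 => i _; exact: sqr_ge0.
have nn : (0 : R) <= n%:R by [].
have n2 : (0 : R) <= 2 * n%:R by rewrite mulr_ge0.
apply: addr_ge0; apply: mulr_ge0 => //.
  exact: addr_ge0 (addr_ge0 (sq _ _ _) (mulr_ge0 n2 (sqr_ge0 _)))
    (mulr_ge0 nn (sqr_ge0 _)).
exact: addr_ge0 (sq _ _ _) (mulr_ge0 nn (sqr_ge0 _)).
Qed.

Lemma dispersion_ge0 (x : 'I_n -> V) s y : 0 <= dispersion x s y.
Proof.
apply: addr_ge0; last by apply: mulr_ge0 => //; exact: sqr_ge0.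
by apply: sumr_ge0 => i _; exact: sqr_ge0.
Qed.

(** The increments cancel on every sample path, whatever the compressors return: the server receives
    half the average of the [c_i], with weight [2 * n%:R], and the multiples of [c_s] sum to
    zero. *)
Lemma conserved_process t w : conserved z0 -> conserved (z t w).
Proof.
move=> c0; elim: t => [//|t]; rewrite /z/= -/z; move: (z t w) => s.
rewrite /conserved /bicolor_step; case: (theta t w) => //= cs.
rewrite -[RHS]cs sumrB -scaler_sumr sumrB sumr_const card_ord.
have nR : (n%:R : R) != 0 by rewrite pnatr_eq0 -lt0n.
move: (\sum_(i < n) Cw _ _ _ _) (Cs _ _ _) (\sum_(i < n) uw _ _) => u v w'.
rewrite -[v *+ n]scaler_nat; apply/rowP => j; rewrite !mxE.
by field; rewrite nR gt_eqF.
Qed.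

(** [round_balance] averages the two outcomes of the coin into an expression in the local iterates,
    and [local_steps_le] brings it back to the state before the step. *)
Lemma lyapunov_round t (W : R) (s : state R n d) :
  0 < p t.+1 -> conserved s -> gamma / (eta * p t.+1 ^+ 2) - gamma <= W ->
  mean_le P (fun w => lyapunov gamma f g xstar (gamma / (eta * p t.+1 ^+ 2))
      (bicolor_step gamma eta eta rho rho f fs g (p t.+1)
        (theta t w) (fun i => Cw t i w) (Cs t w) s))
    (lyapunov gamma f g xstar W s - 2 * state_bregman f fs g xstar s
     - p t.+1 * ((1 - c) * rho / gamma) * local_dispersion gamma f fs g s).
Proof.
move=> p0 cs WW; set W' := gamma / _ in WW *.
have W0 : 0 <= W' by rewrite ltW// divr_gt0// mulr_gt0// exprn_gt0.
have gi : 0 <= gamma^-1 by rewrite invr_ge0 ltW.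
set hx := fun i => local_step gamma (f i) (xw s i) (uw s i).
set hs := local_step gamma fs (xs s) (us s).
set hy := local_step gamma g (yv s) (uy s).
set tau := p t.+1 * eta / gamma.
have H1 := round_primal n0 omegas0 omegaav0 rhoE (server_moment t)
  (average_moment t) hx hs hy xstar.
have H2 := round_dual omega0 omegas0 (server_moment t) (joint_moment t) hx hs hy
  (fun i => uw s i - grad (f i) xstar) (uy s - grad g xstar) tau.
have H3 := mean_leD (mean_leZ gi H1) (mean_leZ W0 H2).
have H4 : mean_le P (fun w => lyapunov gamma f g xstar W'
    (bicolor_step gamma eta eta rho rho f fs g (p t.+1)
        true (fun i => Cw t i w) (Cs t w) s))
    (gamma^-1 * (primal_energy hx hs hy xstar - rho * dispersion hx hs hy)
     + W' * (dual_energy f g xstar s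
        - 2 * tau * dual_pairing gamma f fs g xstar s
        + tau ^+ 2 * (1 + 2 * omega + 2 * omegas) * dispersion hx hs hy)).
  apply: (eq_mean_le _ H3) => w; rewrite /lyapunov /dual_energy /=.
  congr (_ + _ * (_ + _ * _)).
    by apply: eq_bigr => i _; congr (enorm _ ^+ 2); rewrite addrAC.
  by congr (enorm _ ^+ 2); rewrite addrAC.
have H5 := @coin_step t _ _ s (measurable_lyapunov gamma f g xstar W')
  (fun s => lyapunov_ge0 s W0) H4.
apply: mean_leW H5.
have := local_steps_le cf cfs cg L0 gamma0 gammaL WW cs stationary.
have := @round_balance R gamma eta rho (p t.+1) _ c
  (primal_energy hx hs hy xstar) (dual_energy f g xstar s)
  (dual_pairing gamma f fs g xstar s) (dispersion hx hs hy) gamma0 eta0 p0 etaE.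
rewrite -/W' -/tau => E h; rewrite [leLHS]E.
by rewrite lerD2r.
Qed.

(** For any reference point, dispersion is at most twice the primal energy around it: the weights
    [1], [2], [1] are exactly those produced by splitting both kinds of differences. With reference
    point [hs], the primal energy of the local iterates equals their dispersion, and [round_primal]
    does not increase it in expectation. *)
Lemma dispersion_round t (s : state R n d) : 0 < p t.+1 -> p t.+1 <= 1 ->
  mean_le P (fun w => let s' := bicolor_step gamma eta eta rho rho f fs g
        (p t.+1) (theta t w) (fun i => Cw t i w) (Cs t w) s in
      dispersion (xw s') (xs s') (yv s'))
    (2 * local_dispersion gamma f fs g s).
Proof.
move=> p0 p1.
set hx := fun i => local_step gamma (f i) (xw s i) (uw s i).
set hs := local_step gamma fs (xs s) (us s).
set hy := local_step gamma g (yv s) (uy s).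
have mD : measurable_functional (fun s : state R n d => dispersion (xw s) (xs s) (yv s)).
  by move=> dT T y [m1 m2 m3 _]; exact: measurable_dispersion.
have key (x : 'I_n -> V) (u y : V) :
    dispersion x u y <= 2 * primal_energy x u y hs.
  rewrite /dispersion /primal_energy.
  have h (i : 'I_n) : enorm (x i - u) ^+ 2 <=
      2 * enorm (x i - hs) ^+ 2 + 2 * enorm (u - hs) ^+ 2.
    have -> : x i - u = (x i - hs) + - (u - hs) by rewrite opprB addrA subrK.
    by rewrite -(enormN (u - hs)); exact: enormD_sqr_le.
  have {}h := ler_sum (index_enum 'I_n) (P := xpredT) (fun i _ => h i).
  rewrite big_split/= sum_ord_const -mulr_sumr in h.
  have h2 : enorm (u - y) ^+ 2 <= 2 * enorm (u - hs) ^+ 2 + 2 * enorm (y - hs) ^+ 2.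
    have -> : u - y = (u - hs) + - (y - hs) by rewrite opprB addrA subrK.
    by rewrite -(enormN (y - hs)); exact: enormD_sqr_le.
  have {}h2 := ler_wpM2l (ler0n R n) h2.
  move: h h2; move: (\sum_(i < n) _) (\sum_(i < n) _) (n%:R) => a b N.
  by move: (enorm _ ^+ 2) (enorm (y - hs) ^+ 2) (enorm _ ^+ 2) => u1 u2 u3 *; lra.
have PEhs : primal_energy hx hs hy hs = dispersion hx hs hy.
  have e0 : enorm (0 : V) ^+ 2 = 0 by rewrite enorm_sqr dot0l.
  rewrite /primal_energy /dispersion subrr e0 mulr0 addr0.
  by rewrite -(enormN (hy - hs)) opprB.
have H1 := round_primal n0 omegas0 omegaav0 rhoE (server_moment t)
  (average_moment t) hx hs hy hs.
have H2 : mean_le P (fun w => let s' := bicolor_step gamma eta eta rho rho f fs g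
        (p t.+1) true (fun i => Cw t i w) (Cs t w) s in
      dispersion (xw s') (xs s') (yv s')) (2 * dispersion hx hs hy).
  have [mm1 pp1 H1'] := mean_leZ (ler0n R 2) H1; rewrite PEhs in H1'; split.
  - have h2 : measurable_fun setT (id : Omega ->
        g_sigma_algebraType (round_blocks (inl t))).
      exact: measurable_id_ambient (@round_blocks_measurable (inl t)).
    have h1 : measurable_fun setT ((fun=> true) : Omega -> bool).
      exact: measurable_cst.
    apply: mD; exact: (@measurable_step_on _ Omega t (p t.+1) _ _ _ h1 h2
      (measurable_state_cst Omega s)).
  - by move=> w; exact: dispersion_ge0.
  - have D0 := dispersion_ge0 hx hs hy.
    apply: (@le_trans _ _ (2 * (dispersion hx hs hy - rho * dispersion hx hs hy))%:E);
      last first.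
      by rewrite lee_fin ler_pM2l// gerBl mulr_ge0// ltW.
    apply: le_trans H1'; apply: ge0_le_integral => //.
    + by move=> w _; rewrite lee_fin dispersion_ge0.
    + apply/measurable_EFinP.
      have h2 : measurable_fun setT (id : Omega ->
          g_sigma_algebraType (round_blocks (inl t))).
        exact: measurable_id_ambient (@round_blocks_measurable (inl t)).
      have h1 : measurable_fun setT ((fun=> true) : Omega -> bool).
        exact: measurable_cst.
      apply: mD; exact: (@measurable_step_on _ Omega t (p t.+1) _ _ _ h1 h2
        (measurable_state_cst Omega s)).
    + exact/measurable_EFinP.
    + by move=> w _; rewrite lee_fin; exact: key.
have H3 := @coin_step t _ _ s mD (fun s => dispersion_ge0 _ _ _) H2.
apply: mean_leW H3 => /=.
have D0 := dispersion_ge0 hx hs hy.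
rewrite -/hs -/hy -/hx.
have : (1 - p t.+1) * dispersion hx hs hy <= (1 - p t.+1) * (2 * dispersion hx hs hy).
  by rewrite ler_wpM2l ?subr_ge0//; lra.
move=> h; apply: le_trans (lerD (lexx _) h) _.
by rewrite -mulrDl addrC subrK mul1r.
Qed.

Lemma state_bregman_ge0 s : 0 <= state_bregman f fs g xstar s.
Proof.
apply: addr_ge0; [apply: addr_ge0|].
- by apply: sumr_ge0 => i _; exact: bregman_ge0 (cf i).1 (cf i).2.
- by rewrite mulr_ge0 ?mulr_ge0//; exact: bregman_ge0 cfs.1 cfs.2.
- by rewrite mulr_ge0//; exact: bregman_ge0 cg.1 cg.2.
Qed.

(** * Telescoping the Lyapunov function *)

Hypothesis c1 : c < 1.
Hypothesis p01 : forall t, 0 < p t.+1 /\ p t.+1 <= 1.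
Variable W : nat -> R.
Hypothesis WS : forall t, W t.+1 = gamma / (eta * p t.+1 ^+ 2).
Hypothesis W_decr : forall t, W t.+1 - gamma <= W t.
Hypothesis W_ge0 : forall t, 0 <= W t.
Hypothesis conserved0 : conserved z0.

Let kappa t := p t.+1 * ((1 - c) * rho / gamma).

Let kappa_gt0 t : 0 < kappa t.
Proof.
by rewrite mulr_gt0 ?(p01 t).1// divr_gt0// mulr_gt0// subr_gt0.
Qed.

Let mB : measurable_functional (state_bregman f fs g xstar).
Proof. by move=> dT T y my; apply: (measurable_state_bregman _ sf sfs sg). Qed.

Let mD : measurable_functional (local_dispersion gamma f fs g).
Proof. by move=> dT T y my; apply: (measurable_local_dispersion _ sf sfs sg). Qed.

(** Written with a sum on the left because these integrals are not yet known to be finite, and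
    subtraction of infinite values would be meaningless. *)
Lemma lyapunov_decrease t :
  (\int[P]_w (lyapunov gamma f g xstar (W t.+1) (z t.+1 w))%:E
   + (2%:E * \int[P]_w (state_bregman f fs g xstar (z t w))%:E
      + (kappa t)%:E * \int[P]_w (local_dispersion gamma f fs g (z t w))%:E)
   <= \int[P]_w (lyapunov gamma f g xstar (W t) (z t w))%:E)%E.
Proof.
pose Psi s := lyapunov gamma f g xstar (W t) s - 2 * state_bregman f fs g xstar s
  - kappa t * local_dispersion gamma f fs g s.
have mW V0 := measurable_lyapunov gamma f g xstar V0.
have mz := measurable_process_ambient t.
have mPsi : measurable_functional Psi.
  move=> dT T y my; apply: measurable_funB; first apply: measurable_funB.
  - exact: mW.
  - by apply: measurable_funM => //; exact: mB.
  - by apply: measurable_funM => //; exact: mD.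
have H w := @lyapunov_round t (W t) (z t w) (p01 t).1
  (conserved_process t w conserved0).
have {}H w : mean_le P (fun w' => lyapunov gamma f g xstar (W t.+1)
    (bicolor_step gamma eta eta rho rho f fs g (p t.+1) (theta t w')
       (fun i => Cw t i w') (Cs t w') (z t w))) (Psi (z t w)).
  by rewrite WS; apply: H; rewrite -WS.
(* [Psi] is a difference, yet it is nonnegative along the process since it bounds the integral of a
   nonnegative function. *)
have Psi0 w : 0 <= Psi (z t w).
  have [_ h0 h] := H w; rewrite -lee_fin; apply: le_trans h.
  by apply: integral_ge0 => w' _; rewrite lee_fin.
have step := @random_step t _ _ (mW (W t.+1)) mPsi
  (fun s => lyapunov_ge0 s (W_ge0 t.+1)) H.
apply: le_trans (leeD step (lexx _)) _.
have B0 s := state_bregman_ge0 s.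
have D0 s : 0 <= local_dispersion gamma f fs g s by exact: dispersion_ge0.
have k0 : 0 <= kappa t by exact: ltW.
rewrite -!ge0_integralZl//; last 4 first.
- by apply/measurable_EFinP; exact: mD.
- by move=> w _; rewrite lee_fin.
- by apply/measurable_EFinP; exact: mB.
- by move=> w _; rewrite lee_fin.
rewrite -!ge0_integralD//; last 8 first.
- by move=> w _; rewrite lee_fin.
- by apply/measurable_EFinP; exact: mPsi.
- by move=> w _; rewrite -!EFinM -EFinD lee_fin addr_ge0// mulr_ge0.
- apply: emeasurable_funD; apply: measurable_funeM; apply/measurable_EFinP.
    exact: mB.
  exact: mD.
- by move=> w _; rewrite -EFinM lee_fin mulr_ge0.
- by apply: measurable_funeM; apply/measurable_EFinP; exact: mB.
- by move=> w _; rewrite -EFinM lee_fin mulr_ge0.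
- by apply: measurable_funeM; apply/measurable_EFinP; exact: mD.
rewrite le_eqVlt; apply/orP; left; apply/eqP; apply: eq_integral => w _.
by rewrite -!EFinM -!EFinD /Psi; congr (_%:E); ring.
Qed.

Lemma lyapunov_telescope N :
  (\int[P]_w (lyapunov gamma f g xstar (W N) (z N w))%:E
   + \sum_(t < N)
      (2%:E * \int[P]_w (state_bregman f fs g xstar (z t w))%:E
      + (kappa t)%:E * \int[P]_w (local_dispersion gamma f fs g (z t w))%:E)
   <= (lyapunov gamma f g xstar (W 0) z0)%:E)%E.
Proof.
elim: N => [|N IH].
  rewrite big_ord0 adde0.
  by have [_ _] := mean_le_cst P (lyapunov_ge0 z0 (W_ge0 0)).
rewrite big_ord_recr/= addeCA.
rewrite addeC in IH.
by apply: le_trans IH; rewrite leeD2l// lyapunov_decrease.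
Qed.

(** Finiteness is recovered here: both integrals occur with positive coefficients in a sum bounded
    by the initial energy, so neither can be infinite, and they may be replaced by real numbers. *)
Lemma energy_sums : exists B S : nat -> R, [/\
  forall t, mean_le P (fun w => state_bregman f fs g xstar (z t w)) (B t),
  forall t, mean_le P (fun w => local_dispersion gamma f fs g (z t w)) (S t) &
  forall N, \sum_(t < N) (2 * B t + kappa t * S t)
    <= lyapunov gamma f g xstar (W 0) z0].
Proof.
pose b t := (\int[P]_w (state_bregman f fs g xstar (z t w))%:E)%E.
pose s t := (\int[P]_w (local_dispersion gamma f fs g (z t w))%:E)%E.
have b0 t : (0 <= b t)%E.
  by apply: integral_ge0 => w _; rewrite lee_fin state_bregman_ge0.
have s0 t : (0 <= s t)%E.
  by apply: integral_ge0 => w _; rewrite lee_fin dispersion_ge0.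
have x0 t : (0 <= 2%:E * b t + (kappa t)%:E * s t)%E.
  by rewrite adde_ge0// mule_ge0// lee_fin ltW.
have tele N : (\sum_(t < N) (2%:E * b t + (kappa t)%:E * s t)
    <= (lyapunov gamma f g xstar (W 0) z0)%:E)%E.
  apply: le_trans (lyapunov_telescope N); apply: leeDr.
  by apply: integral_ge0 => w _; rewrite lee_fin lyapunov_ge0.
have fin t : (2%:E * b t + (kappa t)%:E * s t < +oo)%E.
  apply: (@le_lt_trans _ _ (\sum_(k < t.+1) (2%:E * b k + (kappa k)%:E * s k))%E).
    by rewrite big_ord_recr/= leeDr// sume_ge0.
  by apply: le_lt_trans (tele t.+1) _; rewrite ltry.
have bfin t : b t \is a fin_num.
  rewrite ge0_fin_numE// ltNge; apply/negP; rewrite leye_eq => /eqP bt.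
  have := fin t; rewrite bt mulry gtr0_sg// mul1e addye ?ltxx//.
  by rewrite gt_eqF// (lt_le_trans ltNy0)// mule_ge0// lee_fin ltW.
have sfin t : s t \is a fin_num.
  rewrite ge0_fin_numE// ltNge; apply/negP; rewrite leye_eq => /eqP st.
  have := fin t; rewrite st mulry gtr0_sg ?kappa_gt0// mul1e addey ?ltxx//.
  by rewrite gt_eqF// (lt_le_trans ltNy0)// mule_ge0// lee_fin.
exists (fun t => fine (b t)), (fun t => fine (s t)); split=> [t|t|N].
- split; [exact: mB (measurable_process_ambient t)| |by rewrite fineK].
  by move=> w; exact: state_bregman_ge0.
- split; [exact: mD (measurable_process_ambient t)| |by rewrite fineK].
  by move=> w; exact: dispersion_ge0.
- rewrite -lee_fin; apply: le_trans (tele N); rewrite -sumEFin le_eqVlt.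
  apply/orP; left; apply/eqP/eq_bigr => t _.
  by rewrite EFinD !EFinM !fineK.
Qed.

Lemma process_dispersion t (S : R) :
  mean_le P (fun w => local_dispersion gamma f fs g (z t w)) S ->
  mean_le P (fun w => dispersion (xw (z t.+1 w)) (xs (z t.+1 w)) (yv (z t.+1 w)))
    (2 * S).
Proof.
move=> HS.
have mX : measurable_functional
    (fun s : state R n d => dispersion (xw s) (xs s) (yv s)).
  by move=> dT T y [m1 m2 m3 _]; exact: measurable_dispersion.
have mL : measurable_functional (fun s => 2 * local_dispersion gamma f fs g s).
  move=> dT T y my; apply: measurable_funM => //.
  exact: mD.
split; [exact: mX (measurable_process_ambient t.+1)| |].
  by move=> w; exact: dispersion_ge0.
have [_ _] := mean_leZ (ler0n R 2) HS; apply: le_trans.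
apply: (@random_step t _ _ mX mL) => [s|w]; first exact: dispersion_ge0.
by have [h1 h2] := p01 t; exact: (@dispersion_round t (z t w) h1 h2).
Qed.

End process.

(** * Random horizon and communication count *)

Section random_horizon.
Context {R : realType} {dO : measure_display} {Omega : measurableType dO}.
Variable P : probability Omega R.

Lemma mean_le_dominated (f h : Omega -> R) (a : R) :
  measurable_fun setT f -> (forall w, 0 <= f w) -> (forall w, f w <= h w) ->
  mean_le P h a -> mean_le P f a.
Proof.
move=> mf f0 fh [mh h0 ha]; split=> //; apply: le_trans ha.
apply: ge0_le_integral => //.
- by move=> w _; rewrite lee_fin.
- exact/measurable_EFinP.
- exact/measurable_EFinP.
- by move=> w _; rewrite lee_fin.
Qed.

(** Split according to the value of [X]: the event [X = k] acts as a coin independent of [h k], with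
    value zero on the other outcome. *)
Lemma mean_le_uniform (K : set_system Omega) (N : nat) (X : {RV P >-> nat})
    (h : nat -> Omega -> R) (a : nat -> R) :
  sigma_algebra setT K -> K `<=` measurable ->
  uniform_below P N X -> independent P (sigma_of X) K ->
  (forall k, measurable_fun [set: g_sigma_algebraType K]
    (h k : g_sigma_algebraType K -> R)) ->
  (forall k, mean_le P (h k) (a k)) ->
  mean_le P (fun w => h (X w) w) (N%:R^-1 * \sum_(k < N) a k).
Proof.
move=> sK Km uX ind mh ha.
have mX k : measurable_fun setT (fun w => X w == k).
  move=> _ D mD.
  by have := measurable_funP X measurableT ((fun m : nat => m == k) @^-1` D); exact.
have H k : mean_le P (fun w => if X w == k then h k w else 0)
    ((if (k < N)%N then N%:R^-1 else 0) * a k).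
  have pre : (fun w => X w == k) @^-1` [set true] = X @^-1` [set k].
    by apply/seteqP; split=> w /= /eqP.
  have PX : P ((fun w => X w == k) @^-1` [set true]) =
      (if (k < N)%N then N%:R^-1 else 0)%:E by rewrite pre; exact: uX.
  have indk : independent P (sigma_of (fun w => X w == k)) K.
    move=> _ B [D mD <-] KB; apply: ind => //.
    exists ((fun m : nat => m == k) @^-1` D) => //.
  have := mean_le_coin sK Km (mX k) PX indk (mh k) (ha k) (lexx 0).
  by rewrite mulr0 addr0.
have HS := mean_le_sum (index_enum 'I_N) (fun k : 'I_N => H k).
have mhX : measurable_fun setT (fun w => h (X w) w).
  move=> _ B mB; rewrite setTI.
  have -> : (fun w => h (X w) w) @^-1` B
      = \bigcup_k (X @^-1` [set k] `&` h k @^-1` B).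
    by apply/seteqP; split=> [w Bw|w [k _ [/= <-]]//]; exists (X w).
  apply: bigcupT_measurable => k; apply: measurableI.
    rewrite -[X in measurable X]setTI; exact: (measurable_funP X).
  have [mhk _ _] := ha k; rewrite -[X in measurable X]setTI; exact: mhk.
have [mS S0 HS'] := HS.
(* Equality holds only almost everywhere: values of [X] beyond [N] have probability zero but may
   occur. *)
have E : (\int[P]_w (h (X w) w)%:E =
    \int[P]_w (\sum_(k < N) (if X w == k then h k w else 0))%:E)%E.
  apply: ge0_ae_eq_integral => //.
  - exact/measurable_EFinP.
  - exact/measurable_EFinP.
  - by move=> w _; rewrite lee_fin; have [_ h0 _] := ha (X w).
  - by move=> w _; rewrite lee_fin.
  - have neg : P.-negligible (\bigcup_k (if (k < N)%N then set0 else X @^-1` [set k])).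
      apply: negligible_bigcup => k; case: ifP => kN; first exact: negligible_set0.
      apply/negligibleP.
        rewrite -[X in measurable X]setTI; exact: (measurable_funP X).
      by have := uX k; rewrite kN.
    apply: (negligibleS _ neg) => w /= nE; exists (X w) => //.
    case: ifP => // XN; exfalso; apply: nE => _.
    rewrite (bigD1 (Ordinal XN))//= eqxx big1 ?addr0// => i /negP ne.
    case: eqP => // Xi; exfalso; apply: ne; apply/eqP/val_inj => /=.
    by rewrite Xi.
split=> //; first by move=> w; have [_ h0 _] := ha (X w).
rewrite E; apply: le_trans HS' _; rewrite lee_fin mulr_sumr le_eqVlt.
by apply/orP; left; apply/eqP/eq_bigr => k _; rewrite ltn_ord.
Qed.

Lemma expectation_coins (theta : nat -> {RV P >-> bool}) (p : nat -> R) (N : nat) :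
  (forall t, P (theta t @^-1` [set true]) = (p t.+1)%:E) ->
  ('E_P[fun w => (\sum_(0 <= t < N) (theta t w)%:R)%R]
    = (\sum_(1 <= t < N.+1) p t)%:E)%E.
Proof.
move=> coin.
have mT t : measurable (theta t @^-1` [set true]).
  by rewrite -[X in measurable X]setTI; exact: (measurable_funP (theta t)).
have E t w : (theta t w)%:R = \1_(theta t @^-1` [set true]) w :> R.
  rewrite indicE; case th : (theta t w); first by rewrite mem_set.
  by rewrite memNset//= th.
rewrite unlock.
under eq_integral => w _.
  under eq_bigr do rewrite E.
  rewrite -sumEFin; over.
rewrite ge0_integral_sum//.
- rewrite big_add1 /= -sumEFin; apply: eq_bigr => t _.
  have h := expectation_indic P (mT t); rewrite unlock in h.
  by apply: eq_trans h _; exact: coin.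
- by move=> t; apply/measurable_EFinP; exact: measurable_indic.
Qed.

End random_horizon.

Section communication_count.
Context {R : realType}.

(** Each term is at most a telescoping difference: with [v] and [u] the roots of [N.+1] and [N], the
    bound [v^-1 <= 2 * (v - u)] amounts to [0 <= (v - u) ^+ 2]. *)
Lemma sum_prob_le (a b : R) (p : nat -> R) (N : nat) : 0 <= a -> 0 < b ->
  (forall t, (1 <= t)%N -> p t = Num.sqrt (b / (a + t%:R))) ->
  \sum_(1 <= t < N.+1) p t <= 2 * Num.sqrt b * Num.sqrt N%:R.
Proof.
move=> a0 b0 pE; elim: N => [|N IH]; first by rewrite big_nil sqrtr0 mulr0.
rewrite big_nat_recr//=; apply: le_trans (lerD IH (lexx _)) _.
rewrite pE//; set u := Num.sqrt N%:R; set v := Num.sqrt N.+1%:R.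
have u0 : 0 <= u by exact: sqrtr_ge0.
have v0 : 0 < v by rewrite sqrtr_gt0 ltr0n.
have uv : v ^+ 2 = u ^+ 2 + 1 by rewrite !sqr_sqrtr ?ler0n// -natr1.
have h1 : Num.sqrt (b / (a + N.+1%:R)) <= Num.sqrt b / v.
  have bv : 0 <= Num.sqrt b / v by rewrite divr_ge0 ?sqrtr_ge0// ltW.
  rewrite -[leRHS]ger0_norm// -sqrtr_sqr ler_wsqrtr// expr_div_n.
  rewrite !sqr_sqrtr ?ler0n ?(ltW b0)// ler_pM2l// lef_pV2 ?posrE ?ltr0n//.
    by rewrite lerDr.
  by rewrite ltr_wpDl// ltr0n.
have h2 : v^-1 <= 2 * (v - u).
  rewrite -[leLHS]mul1r ler_pdivrMr//.
  have := sqr_ge0 (v - u); rewrite sqrrB; move: uv; rewrite !expr2 => uv'; lra.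
have := ler_wpM2l (sqrtr_ge0 b) h2; lra.
Qed.

(** For [t <= N] one has [a + t <= (a + 1) * N], so each of the [N] terms is at least the constant
    divided by the root of [N]. *)
Lemma sum_prob_ge (a b : R) (p : nat -> R) (N : nat) : 0 <= a -> 0 < b ->
  (1 <= N)%N -> (forall t, (1 <= t)%N -> p t = Num.sqrt (b / (a + t%:R))) ->
  Num.sqrt (b / (a + 1)) * Num.sqrt N%:R <= \sum_(1 <= t < N.+1) p t.
Proof.
move=> a0 b0 N1 pE.
have Np : (0 : R) < N%:R by rewrite ltr0n.
have h t : (1 <= t < N.+1)%N -> Num.sqrt (b / (a + 1)) / Num.sqrt N%:R <= p t.
  move=> /andP[t1 tN]; rewrite pE// -sqrtrV ?ler0n// -sqrtrM; last first.
    by rewrite divr_ge0 ?(ltW b0)// addr_ge0.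
  rewrite ler_wsqrtr// -mulrA ler_pM2l// -invfM lef_pV2 ?posrE.
  - rewrite mulrDl mul1r lerD//; last by rewrite ler_nat.
    by rewrite ler_peMr// ler1n.
  - by rewrite mulr_gt0// ltr_wpDl.
  - by rewrite ltr_wpDl// ltr0n.
apply: (@le_trans _ _ (\sum_(1 <= t < N.+1)
    (Num.sqrt (b / (a + 1)) / Num.sqrt N%:R))); last exact: ler_sum_nat.
have s0 : 0 < Num.sqrt (N%:R : R) by rewrite sqrtr_gt0.
rewrite sumr_const_nat subn1/=.
set A := Num.sqrt (b / (a + 1)); set u := Num.sqrt (N%:R : R) in s0 *.
have uN : N%:R = u ^+ 2 by rewrite sqr_sqrtr// ltW.
have -> : (A / u) *+ N = A * u.
  by rewrite -[LHS]mulr_natr uN; field; rewrite gt_eqF.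
by [].
Qed.

Lemma le_absz_ceil (x : R) : 0 <= x -> x <= `|Num.ceil x|%N%:R.
Proof.
move=> x0; have c0 : 0 <= Num.ceil x by rewrite ceil_ge0 (lt_le_trans _ x0)// ltrN10.
by rewrite pmulrn gez0_abs// ceil_ge.
Qed.

(** The initial term [D] is absorbed because the root of [T] is at least one; dividing by [T] leaves
    the inverse root, of order the root of [eps] by the lower bound on the horizon. *)
Lemma dispersion_rate (D G E eps Sg : R) (T : nat) : 0 <= D -> 0 <= G ->
  0 < E -> 0 < eps -> (1 <= T)%N -> (2 * eps)^-1 * E <= T%:R ->
  Sg <= D + 2 * (G * Num.sqrt T%:R) ->
  T%:R^-1 * Sg <= (D + 2 * G) * Num.sqrt (2 / E) * Num.sqrt eps.
Proof.
move=> D0 G0 E0 e0 T1 ET h.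
have Tp : (0 : R) < T%:R by rewrite ltr0n.
set u := Num.sqrt (T%:R : R) in h *.
have u0 : 0 < u by rewrite sqrtr_gt0.
have u1 : 1 <= u by rewrite -sqrtr1 ler_wsqrtr// ler1n.
have uT : T%:R = u ^+ 2 by rewrite sqr_sqrtr// ltW.
apply: (@le_trans _ _ ((D + 2 * G) * u^-1)).
  rewrite mulrC ler_pdivrMr// uT; apply: le_trans h _.
  have -> : (D + 2 * G) / u * u ^+ 2 = (D + 2 * G) * u by field; rewrite gt_eqF.
  have := ler_wpM2l D0 u1; lra.
rewrite -mulrA ler_wpM2l ?addr_ge0 ?mulr_ge0//.
rewrite -sqrtrM ?divr_ge0 ?(ltW E0)// -sqrtrV ?ler0n// ler_wsqrtr//.
have x0 : 0 < (2 * eps)^-1 * E by rewrite mulr_gt0// invr_gt0 mulr_gt0.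
have -> : 2 / E * eps = ((2 * eps)^-1 * E)^-1 by field; rewrite !gt_eqF.
by rewrite lef_pV2 ?posrE.
Qed.

Lemma near0_right (e : R) (Q : R -> Prop) : 0 < e ->
  (forall eps, 0 < eps -> eps <= e -> Q eps) -> \forall eps \near 0^'+, Q eps.
Proof.
move=> e0 H; near=> eps; apply: H; near: eps; first exact: nbhs_right_gt.
exact: nbhs_right_le.
Unshelve. all: by end_near. Qed.

(** For [eps <= E / 2] the number under the ceiling is at least one, so rounding up at most doubles
    it. *)
Lemma ceil_horizon_bounds (E eps : R) : 0 < E -> 0 < eps -> eps <= E / 2 ->
  E / 2 / eps <= `|Num.ceil ((2 * eps)^-1 * E)|%N%:R <= E / eps.
Proof.
move=> E0 e0 eE; set x := (2 * eps)^-1 * E.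
have x0 : 0 < x by rewrite mulr_gt0// invr_gt0 mulr_gt0.
have x1 : 1 <= x by rewrite /x mulrC ler_pdivlMr ?mulr_gt0// mul1r; lra.
have c0 : 0 <= Num.ceil x by rewrite ceil_ge0 (lt_trans _ x0)// ltrN10.
have -> : (`|Num.ceil x|%N%:R : R) = (Num.ceil x)%:~R.
  by rewrite pmulrn gez0_abs.
have -> : E / 2 / eps = x by rewrite /x; field; rewrite gt_eqF.
have -> : E / eps = x + x by rewrite /x; field; rewrite gt_eqF.
rewrite ceil_ge/=; have := ceilB1_lt x; rewrite intrD => h.
by move: h; rewrite -[(-1)%:~R]/(-1 : R); lra.
Qed.

End communication_count.

(** * Convergence *)

Lemma scaled_balance (R : realType) (d n : nat) (u v w : 'rV[R]_d) : (0 < n)%N ->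
  n%:R^-1 *: u + 2 *: v + w = 0 -> u + (2 * n%:R) *: v + n%:R *: w = 0.
Proof.
move=> n0 /(congr1 (fun x => n%:R *: x)).
rewrite !scalerDr !scalerA scaler0 mulfV ?scale1r; first by rewrite (mulrC n%:R).
by rewrite pnatr_eq0 -lt0n.
Qed.

Lemma initial_energyE (R : realType) (d n : nat) (gamma eta a b : R)
    (f : 'I_n -> 'rV[R]_d -> R) (g : 'rV[R]_d -> R) (xstar : 'rV[R]_d)
    (z0 : state R n d) :
  lyapunov gamma f g xstar (gamma * (a + 0%:R) / (eta * b)) z0
  = initial_energy gamma eta a b f g xstar z0.
Proof.
rewrite /lyapunov /primal_energy /dual_energy /initial_energy addr0.
by rewrite !mulrDr !addrA; congr (_ + _ + _ + _ + _); ring.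
Qed.

Lemma sum_split_bounds (R : realType) (N : nat) (B S k : nat -> R) (E m : R) :
  (forall t, 0 <= B t) -> (forall t, 0 <= S t) -> 0 < m ->
  (forall t, (t < N)%N -> m <= k t) ->
  \sum_(t < N) (2 * B t + k t * S t) <= E ->
  \sum_(t < N) B t <= E / 2 /\ \sum_(t < N) S t <= E / m.
Proof.
move=> B0 S0 m0 mk h.
have k0 (t : 'I_N) : 0 <= k t by apply: ltW; apply: lt_le_trans m0 (mk _ _).
split.
  rewrite ler_pdivlMr// mulr_suml; apply: le_trans h; apply: ler_sum => t _.
  by rewrite mulrC lerDl mulr_ge0.
rewrite ler_pdivlMr// mulr_suml; apply: le_trans h; apply: ler_sum => t _.
rewrite mulrC; apply: le_trans (ler_wpM2r (S0 t) (mk t (ltn_ord t))) _.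
by rewrite lerDr mulr_ge0.
Qed.

Lemma mean_le_ge0 (R : realType) (dO : measure_display) (Omega : measurableType dO)
    (P : probability Omega R) (h : Omega -> R) (a : R) : mean_le P h a -> 0 <= a.
Proof.
move=> [_ h0 ha]; rewrite -lee_fin; apply: le_trans ha.
by apply: integral_ge0 => w _; rewrite lee_fin.
Qed.

(* k1, k2 are the constants in gamma = Theta(1/L), and K1, K2 those hidden in the
   Theta of the last conclusion: they depend on n, a, b, eta, k1 and k2 only.
   The other conclusions do not involve k1, k2, K1, K2. *)
Theorem theorem4p4 (R : realType) (n : nat) (a b eta k1 k2 : R) :
  (1 <= n)%N -> 0 < k1 -> 0 < k2 ->
  exists K1 K2 : R, [/\ 0 < K1, 0 < K2 &
  forall (d : nat) (L gamma rho C omega omegas omegaav : R)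
    (f : 'I_n -> 'rV[R]_d -> R) (fs g : 'rV[R]_d -> R) (xstar : 'rV[R]_d)
    (p : nat -> R) (z0 : state R n d)
    (dO : measure_display) (Omega : measurableType dO)
    (P : probability Omega R)
    (F Fs : nat -> set_system Omega)
    (Cw : nat -> 'I_n -> Omega -> 'rV[R]_d -> 'rV[R]_d)
    (Cs : nat -> Omega -> 'rV[R]_d -> 'rV[R]_d)
    (theta : nat -> {RV P >-> bool}) (tt : R -> {RV P >-> nat}),
  let z := bicolor gamma eta eta rho rho f fs g p theta Cw Cs z0 in
  let T := horizon gamma eta a b f g xstar z0 in
  (1 <= d)%N -> 0 < L ->
  (forall i, convex (f i) /\ smooth L (f i)) ->
  convex fs /\ smooth L fs -> convex g /\ smooth L g ->
  (forall x, n%:R^-1 * (\sum_(i < n) f i xstar) + 2 * fs xstar + g xstar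
             <= n%:R^-1 * (\sum_(i < n) f i x) + 2 * fs x + g x) ->
  0 <= omega -> 0 <= omegas -> 0 <= omegaav ->
  compressor_assumption omega omegas omegaav F Fs Cw Cs theta ->
  (forall t, P (theta t @^-1` [set true]) = (p t.+1)%:E) ->
  n%:R^-1 *: (\sum_(i < n) uw z0 i) + 2 *: us z0 + uy z0 = 0 ->
  0 < gamma -> gamma <= L^-1 ->
  rho = (2 + omegaav + 2 * omegas)^-1 ->
  0 < C -> C < 1 ->
  eta = C / ((1 + 2 * omega + 2 * omegas) * (2 + omegaav + 2 * omegas)) ->
  eta^-1 <= b -> b - 1 <= a ->
  (forall t, (1 <= t)%N ->
     [/\ p t = Num.sqrt (b / (a + t%:R)), 0 < p t & p t <= 1]) ->
  (forall eps, 0 < eps -> (1 <= T eps)%N) ->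
  (forall eps, 0 < eps ->
     uniform_below P (T eps) (tt eps) /\
     independent P (sigma_of (tt eps)) (algorithm_sigma F Fs theta)) ->
  [/\ (* (i) *)
      (forall eps, 0 < eps ->
        ('E_P[fun w => (\sum_(i < n) bregman (f i) (xw (z (tt eps w) w) i) xstar
                + 2 * n%:R * bregman fs (xs (z (tt eps w) w)) xstar
                + n%:R * bregman g (yv (z (tt eps w) w)) xstar)%R]
         <= eps%:E)%E),
      (* (ii) *)
      (exists K : R, \forall eps \near 0^'+,
        ('E_P[fun w => (gamma^-1 * \sum_(i < n)
                enorm (xw (z (tt eps w) w) i - xs (z (tt eps w) w)) ^+ 2)%R]
         <= (K * Num.sqrt eps)%:E)%E) /\
      (exists K : R, \forall eps \near 0^'+,
        ('E_P[fun w => (n%:R / gamma *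
                enorm (xs (z (tt eps w) w) - yv (z (tt eps w) w)) ^+ 2)%R]
         <= (K * Num.sqrt eps)%:E)%E),
      (* (iii) *)
      [/\ (forall N : nat, (1 <= N)%N ->
            'E_P[fun w => (\sum_(0 <= t < N) (theta t w)%:R)%R]
            = (\sum_(1 <= t < N.+1) p t)%:E)%E,
          (exists l1 l2 : R, [/\ 0 < l1, 0 < l2 & forall N : nat, (1 <= N)%N ->
            l1 * Num.sqrt N%:R <= \sum_(1 <= t < N.+1) p t
              <= l2 * Num.sqrt N%:R]),
          (exists l1 l2 : R, [/\ 0 < l1, 0 < l2 & \forall eps \near 0^'+,
            l1 * (Num.sqrt eps)^-1 <= Num.sqrt (T eps)%:R
              <= l2 * (Num.sqrt eps)^-1]) &
          (exists l1 l2 : R, [/\ 0 < l1, 0 < l2 & \forall eps \near 0^'+,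
            ((l1 * (Num.sqrt eps)^-1)%:E
             <= 'E_P[fun w => (\sum_(0 <= t < T eps) (theta t w)%:R)%R]
             <= (l2 * (Num.sqrt eps)^-1)%:E)%E])] &
      (* (iv) *)
      (forall x0 : 'rV[R]_d,
        k1 / L <= gamma <= k2 / L ->
        (forall i, xw z0 i = x0) -> xs z0 = x0 -> yv z0 = x0 ->
        (forall i, uw z0 i = grad (f i) x0) -> uy z0 = grad g x0 ->
        \forall eps \near 0^'+,
          K1 * (Num.sqrt (L / eps) * enorm (x0 - xstar))
            <= Num.sqrt (T eps)%:R
            <= K2 * (Num.sqrt (L / eps) * enorm (x0 - xstar)))]].

Proof.
move=> n1 k10 k20.
have nR : (0 : R) < n%:R by rewrite ltr0n.
(* The first summand bounds the primal part (weights [n], [2 * n] and [n], with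
   [gamma^-1 <= L / k1]), the second the dual part. The absolute value ensures positivity before the
   hypotheses giving the signs of [a], [b] and [eta] are available. *)
pose k2c := 4 * n%:R / k1 + 2 * n%:R * `|a / (eta * b)|.
have k2c0 : 0 < k2c by rewrite ltr_wpDr ?mulr_ge0// divr_gt0// mulr_gt0.
(* The lower constant comes from an initial energy of at least [4 * n%:R / k2 * L] times the squared
   distance, halved by the lower bound on the horizon. *)
exists (Num.sqrt (2 * n%:R / k2)), (Num.sqrt k2c).
split; [by rewrite sqrtr_gt0 divr_gt0// mulr_gt0|by rewrite sqrtr_gt0|].
move=> d L gamma rho C omega omegas omegaav f fs g xstar p z0 dO Omega P F Fs Cw
  Cs theta tt z T d1 L0 cf cfs cg opt om0 oms0 omav0 ca coin init g0 gL rhoD C0 C1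
  etaD be ab pE T1 htt.
have Y0 : 0 < 2 + omegaav + 2 * omegas by lra.
have X1 : 1 <= 1 + 2 * omega + 2 * omegas by lra.
have X0 : 0 < 1 + 2 * omega + 2 * omegas by lra.
have rho0 : 0 < rho by rewrite rhoD invr_gt0.
have rhoE : rho * (2 + omegaav + 2 * omegas) = 1 by rewrite rhoD mulVf// gt_eqF.
have eta0 : 0 < eta by rewrite etaD divr_gt0// mulr_gt0.
have etaE : eta * (1 + 2 * omega + 2 * omegas) = C * rho.
  by rewrite etaD rhoD; field; rewrite !gt_eqF.
(* Through [eta^-1 <= b] this gives [b >= 1], and then [b - 1 <= a] gives [a >= 0]. *)
have eta1 : eta <= 1.
  rewrite etaD ler_pdivrMr ?mulr_gt0// mul1r.
  have : 1 * 2 <= (1 + 2 * omega + 2 * omegas) * (2 + omegaav + 2 * omegas).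
    by apply: ler_pM => //; lra.
  lra.
have b1 : 1 <= b.
  by apply: le_trans be; rewrite -[leLHS]invr1 lef_pV2 ?posrE.
have b0 : 0 < b by exact: lt_le_trans b1.
have a0 : 0 <= a by lra.
have etab : 1 <= eta * b by rewrite mulrC -ler_pdivrMr// mul1r.
have p01 t : 0 < p t.+1 /\ p t.+1 <= 1 by have [] := pE t.+1 isT.
have pE' t : (1 <= t)%N -> p t = Num.sqrt (b / (a + t%:R)).
  by move=> t1; have [] := pE t t1.
(* Extends [gamma / (eta * p t ^+ 2)] to [t = 0], where [p] is unconstrained; the value there is the
   dual weight of the initial energy. *)
pose W (t : nat) := gamma * (a + t%:R) / (eta * b).
have W_ge0 t : 0 <= W t.
  by rewrite divr_ge0 ?mulr_ge0 ?addr_ge0 ?ler0n// ltW.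
have at0 t : 0 < a + t.+1%:R by rewrite ltr_wpDl// ltr0n.
have WS t : W t.+1 = gamma / (eta * p t.+1 ^+ 2).
  rewrite /W pE'// sqr_sqrtr ?divr_ge0 ?(ltW b0) ?(ltW (at0 t))//.
  by move: (a + t.+1%:R) (at0 t) => y y0; field; rewrite !gt_eqF.
have W_decr t : W t.+1 - gamma <= W t.
  have -> : W t.+1 = W t + gamma / (eta * b).
    by rewrite /W -natr1; field; rewrite !gt_eqF.
  have : gamma / (eta * b) <= gamma.
    by rewrite ler_pdivrMr ?mulr_gt0// ler_peMr// ltW.
  lra.
have cons0 : conserved z0 by exact: scaled_balance n1 init.
have stat := scaled_balance n1 (first_order_optimality (fun i => (cf i).2) cfs.2
  cg.2 opt).
pose E := initial_energy gamma eta a b f g xstar z0.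
have EE : lyapunov gamma f g xstar (W 0) z0 = E by exact: initial_energyE.
have E_ge0 : 0 <= E.
  by have := lyapunov_ge0 f g xstar g0 z0 (W_ge0 0); rewrite EE.
(* A zero energy would give a zero horizon, against the assumption that it is at least one, taken at
   [eps = 1]. *)
have E0 : 0 < E.
  rewrite lt_def E_ge0 andbT; apply/eqP => Ez.
  by have := T1 1 ltr01; rewrite /T /horizon -/E Ez mulr0 ceil0.
have [B [S [HB HS HBS]]] := energy_sums n1 ca om0 oms0 omav0 cf cfs cg L0 g0 gL
  eta0 rho0 rhoE etaE stat coin C1 p01 WS W_decr W_ge0 cons0.
rewrite EE in HBS.
have B0 t := mean_le_ge0 (HB t).
have S0 t := mean_le_ge0 (HS t).
have Tge eps : 0 < eps -> (2 * eps)^-1 * E <= (T eps)%:R.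
  by move=> e0; apply: le_absz_ceil; rewrite mulr_ge0// invr_ge0 mulr_ge0// ltW.
have C1' : 0 < 1 - C by rewrite subr_gt0.
pose r := (1 - C) * rho / gamma.
have r0 : 0 < r by rewrite divr_gt0// mulr_gt0// subr_gt0.
(* Since [p] is decreasing, its value at [N] bounds all the earlier coefficients of the dispersion
   from below. *)
have bounds N : (1 <= N)%N -> \sum_(t < N) B t <= E / 2 /\
    \sum_(t < N) S t <= E / (Num.sqrt (b / (a + N%:R)) * r).
  move=> N1; have aN : 0 < a + N%:R by rewrite ltr_wpDl// ltr0n.
  apply: (@sum_split_bounds R N B S (fun t => p t.+1 * r) E
    (Num.sqrt (b / (a + N%:R)) * r) B0 S0 _ _ (HBS N)) => [|t tN].
    by rewrite mulr_gt0// sqrtr_gt0 divr_gt0.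
  rewrite ler_wpM2r ?(ltW r0)// pE'// ler_wsqrtr// ler_pM2l// lef_pV2 ?posrE//.
  by rewrite lerD2l ler_nat.
have mz t : measurable_state
    (z t : g_sigma_algebraType (algorithm_sigma F Fs theta) -> state R n d).
  have hid : measurable_fun setT (id :
      g_sigma_algebraType (algorithm_sigma F Fs theta) ->
      g_sigma_algebraType (past F Fs theta t)).
    apply: measurable_id_sub => A /past_sub_algorithm; exact: sub_sigma_algebra.
  exact: (measurable_state_comp hid
    (measurable_process ca gamma eta rho cf cfs cg p z0 t)).
have sA : sigma_algebra setT (algorithm_sigma F Fs theta).
  exact: smallest_sigma_algebra.
have mA := algorithm_sigma_measurable ca.
have part1 eps : 0 < eps -> mean_le P
    (fun w => state_bregman f fs g xstar (z (tt eps w) w)) eps.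
  move=> e0; have [u i] := htt eps e0.
  have mh k : measurable_fun [set: g_sigma_algebraType (algorithm_sigma F Fs theta)]
      (fun w => state_bregman f fs g xstar (z k w)).
    by apply: (measurable_state_bregman _ (fun i => (cf i).2) cfs.2 cg.2 (mz k)).
  have := mean_le_uniform sA mA u i mh HB; apply: mean_leW.
  have Tp : (0 : R) < (T eps)%:R by rewrite ltr0n T1.
  rewrite mulrC ler_pdivrMr//; apply: le_trans (bounds _ (T1 eps e0)).1 _.
  have := ler_wpM2l (ltW e0) (Tge eps e0).
  have -> : eps * ((2 * eps)^-1 * E) = E / 2 by field; rewrite gt_eqF.
  by [].
pose disp (s : state R n d) := dispersion (xw s) (xs s) (yv s).
pose D0 := disp z0.
have D00 : 0 <= D0 by exact: dispersion_ge0.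
pose m := Num.sqrt (b / (a + 1)).
have a1 : 0 < a + 1 by rewrite ltr_wpDl.
have m0 : 0 < m by rewrite sqrtr_gt0 divr_gt0.
(* From [a + N <= (a + 1) * N], the dispersions up to [N] sum to at most [G] times the root of
   [N]. *)
pose G := E / (m * r).
have G0 : 0 <= G by rewrite divr_ge0// ltW// mulr_gt0.
have part2 (phi : state R n d -> R) eps : measurable_functional phi ->
    (forall s, 0 <= phi s) -> (forall s, phi s <= disp s) -> 0 < eps ->
    mean_le P (fun w => phi (z (tt eps w) w))
      ((D0 + 2 * G) * Num.sqrt (2 / E) * Num.sqrt eps).
  move=> mphi phi0 phid e0; have [u i] := htt eps e0.
  have mh k : measurable_fun [set: g_sigma_algebraType (algorithm_sigma F Fs theta)]
      (fun w => phi (z k w)) by exact: mphi (mz k).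
  (* The index shifts by one: the dispersion of the state at [k'.+1] is controlled by that of the
     local iterates at [k'], while the initial state has its own constant. *)
  pose A k := if k is k'.+1 then 2 * S k' else D0.
  have HA k : mean_le P (fun w => phi (z k w)) (A k).
    apply: (@mean_le_dominated _ _ _ _ _ (fun w => disp (z k w))) => //.
      apply: mphi; exact: (measurable_process_ambient ca gamma eta rho cf cfs cg p z0 k).
    case: k => [|k]; first exact: (mean_le_cst P D00).
    exact: (process_dispersion n1 ca oms0 omav0 cf cfs cg rho0 rhoE coin p01 (HS k)).
  have := mean_le_uniform sA mA u i mh HA; apply: mean_leW.
  apply: dispersion_rate (T1 eps e0) (Tge eps e0) _ => //.
  have Tp : (0 : R) < (T eps)%:R by rewrite ltr0n T1.
  apply: (@le_trans _ _ (D0 + 2 * \sum_(t < T eps) S t)).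
    case: (T eps) (T1 eps e0) => // N _.
    rewrite big_ord_recl/= big_ord_recr/= mulrDr lerD2l mulr_sumr lerDl.
    by rewrite mulr_ge0.
  rewrite lerD2l ler_pM2l//; apply: le_trans (bounds _ (T1 eps e0)).2 _.
  set N := T eps in Tp *; have sN : 0 < Num.sqrt (N%:R : R) by rewrite sqrtr_gt0.
  have -> : G * Num.sqrt N%:R = E / (m / Num.sqrt N%:R * r).
    by rewrite /G; field; rewrite !gt_eqF.
  have aN : 0 < a + N%:R by rewrite ltr_wpDl.
  rewrite ler_pM2l// lef_pV2 ?posrE ?mulr_gt0 ?invr_gt0 ?sqrtr_gt0 ?divr_gt0//.
  rewrite ler_pM2r// -sqrtrV ?ler0n// -sqrtrM ?divr_ge0 ?(ltW b0) ?(ltW a1)//.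
  rewrite ler_wsqrtr// -mulrA ler_pM2l// -invfM lef_pV2 ?posrE ?mulr_gt0//.
  rewrite mulrDl mul1r lerD2r ler_peMr//.
  by rewrite ler1n T1.
have gi : 0 <= gamma^-1 by rewrite invr_ge0 ltW.
pose K := gamma^-1 * ((D0 + 2 * G) * Num.sqrt (2 / E)).
have part2K : forall (psi : state R n d -> R) (e : R), measurable_functional psi ->
    (forall s, 0 <= psi s) -> (forall s, psi s <= disp s) -> 0 < e ->
    mean_le P (fun w => gamma^-1 * psi (z (tt e w) w)) (K * Num.sqrt e).
  move=> psi e mpsi psi0 psid e0; rewrite /K -mulrA.
  exact: (mean_leZ gi (part2 psi e mpsi psi0 psid e0)).
have sq (x : 'rV[R]_d) : 0 <= enorm x ^+ 2 by exact: sqr_ge0.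
have Tb eps : 0 < eps -> eps <= E / 2 -> E / 2 / eps <= (T eps)%:R <= E / eps.
  by move=> e0 eE; exact: ceil_horizon_bounds.
have E2 : 0 < E / 2 by rewrite divr_gt0.
have sqT eps : 0 < eps -> eps <= E / 2 ->
    Num.sqrt (E / 2) * (Num.sqrt eps)^-1 <= Num.sqrt (T eps)%:R
      <= Num.sqrt E * (Num.sqrt eps)^-1.
  move=> e0 eE; have /andP[l u] := Tb eps e0 eE.
  by rewrite -sqrtrV ?(ltW e0)// -!sqrtrM ?(ltW E2)// !ler_wsqrtr.
have sumP N : (1 <= N)%N -> m * Num.sqrt N%:R <= \sum_(1 <= t < N.+1) p t
    <= 2 * Num.sqrt b * Num.sqrt N%:R.
  by move=> N1; rewrite (sum_prob_ge a0 b0 N1 pE') (sum_prob_le _ a0 b0 pE').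
have sb0 : 0 < Num.sqrt b by rewrite sqrtr_gt0.
have coins N := expectation_coins N coin.
split.
- move=> eps e0; have [_ _] := part1 eps e0; by rewrite unlock.
- split; exists K; apply: (near0_right ltr01) => eps e0 _.
  + have mphi : measurable_functional (fun s : state R n d =>
        \sum_(i < n) enorm (xw s i - xs s) ^+ 2).
      move=> dT X y [m1 m2 m3 _]; apply: measurable_sum => i.
      by apply: measurable_enorm_sqr; apply: measurable_borelB.
    have psi0 (s : state R n d) : 0 <= \sum_(i < n) enorm (xw s i - xs s) ^+ 2.
      exact: sumr_ge0.
    have psid (s : state R n d) :
        \sum_(i < n) enorm (xw s i - xs s) ^+ 2 <= disp s.
      by rewrite /disp /dispersion lerDl mulr_ge0.
    have [_ _ h] := part2K _ eps mphi psi0 psid e0.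
    by rewrite unlock; exact: h.
  + have mphi : measurable_functional (fun s : state R n d =>
        n%:R * enorm (xs s - yv s) ^+ 2).
      move=> dT X y [m1 m2 m3 _]; apply: measurable_funM => //.
      by apply: measurable_enorm_sqr; apply: measurable_borelB.
    have psi0 (s : state R n d) : 0 <= n%:R * enorm (xs s - yv s) ^+ 2.
      exact: mulr_ge0.
    have psid (s : state R n d) : n%:R * enorm (xs s - yv s) ^+ 2 <= disp s.
      by rewrite /disp /dispersion lerDr sumr_ge0.
    have [_ _ h] := part2K _ eps mphi psi0 psid e0.
    rewrite unlock; under eq_integral do rewrite [n%:R / gamma]mulrC -mulrA.
    exact: h.
- split.
  + by move=> N _; exact: coins.
  + by exists m, (2 * Num.sqrt b); split=> //; rewrite mulr_gt0.
  + exists (Num.sqrt (E / 2)), (Num.sqrt E).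
    by split; rewrite ?sqrtr_gt0//; exact: near0_right E2 sqT.
  + exists (m * Num.sqrt (E / 2)), (2 * Num.sqrt b * Num.sqrt E).
    split; [by rewrite mulr_gt0// sqrtr_gt0|by rewrite !mulr_gt0// sqrtr_gt0|].
    apply: (near0_right E2) => eps e0 eE; rewrite coins !lee_fin.
    have /andP[l u] := sumP _ (T1 eps e0); have /andP[l' u'] := sqT eps e0 eE.
    apply/andP; split.
      by apply: le_trans l; rewrite -mulrA ler_pM2l.
    by apply: le_trans u _; rewrite -[leRHS]mulrA ler_wpM2l ?mulr_ge0 ?sqrtr_ge0.
- move=> x0 /andP[gk1 gk2] hx hs hy hu huy.
  pose q := enorm (x0 - xstar) ^+ 2.
  have q0 : 0 <= q by exact: sqr_ge0.
  have nq : 0 <= 4 * n%:R * q.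
    by apply: mulr_ge0 q0; apply: mulr_ge0 => //; exact: ltW.
  have q1 : enorm (x0 - xstar) = Num.sqrt q.
    by rewrite sqrtr_sqr ger0_norm// enorm_ge0.
  have EL : 4 * n%:R / k2 * L * q <= E.
    apply: (@le_trans _ _ (lyapunov gamma f g xstar (W 0) z0)); last by rewrite EE.
    rewrite /lyapunov.
    have PE : primal_energy (xw z0) (xs z0) (yv z0) xstar = 4 * n%:R * q.
      rewrite /primal_energy hs hy; under eq_bigr do rewrite hx.
      by rewrite sum_ord_const /q; ring.
    have DE : 0 <= W 0 * dual_energy f g xstar z0.
      by rewrite mulr_ge0// addr_ge0 ?sumr_ge0// mulr_ge0.
    apply: (@le_trans _ _ (gamma^-1 * (4 * n%:R * q))); last by rewrite PE lerDl.
    have -> : 4 * n%:R / k2 * L * q = (k2 / L)^-1 * (4 * n%:R * q).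
      by field; rewrite !gt_eqF.
    apply: ler_wpM2r; first exact: nq.
    by rewrite lef_pV2 ?posrE// divr_gt0.
  have EU : E <= k2c * L * q.
    apply: (@le_trans _ _ (lyapunov gamma f g xstar (W 0) z0)); first by rewrite EE.
    rewrite /lyapunov.
    have PE : primal_energy (xw z0) (xs z0) (yv z0) xstar = 4 * n%:R * q.
      rewrite /primal_energy hs hy; under eq_bigr do rewrite hx.
      by rewrite sum_ord_const /q; ring.
    have lip (h : 'rV[R]_d -> R) : smooth L h ->
        enorm (grad h x0 - grad h xstar) ^+ 2 <= L ^+ 2 * q.
      by move=> [_ sh]; rewrite /q -exprMn lerXn2r ?nnegrE ?mulr_ge0 ?enorm_ge0// ltW.
    have DE : dual_energy f g xstar z0 <= 2 * n%:R * (L ^+ 2 * q).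
      have h1 : \sum_(i < n) enorm (uw z0 i - grad (f i) xstar) ^+ 2 <=
          n%:R * (L ^+ 2 * q).
        rewrite -sum_ord_const; apply: ler_sum => i _; rewrite hu.
        exact: lip (cf i).2.
      have h2 : n%:R * enorm (uy z0 - grad g xstar) ^+ 2 <= n%:R * (L ^+ 2 * q).
        by rewrite huy ler_wpM2l//; exact: lip cg.2.
      by apply: le_trans (lerD h1 h2) _; lra.
    have aeb : 0 <= a / (eta * b) by rewrite divr_ge0// mulr_ge0// ltW.
    have gL1 : gamma * L <= 1 by rewrite -(mulVf (lt0r_neq0 L0)) ler_pM2r.
    have h1 : gamma^-1 * (4 * n%:R * q) <= 4 * n%:R / k1 * L * q.
      have -> : 4 * n%:R / k1 * L * q = (k1 / L)^-1 * (4 * n%:R * q).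
        by field; rewrite !gt_eqF.
      apply: ler_wpM2r; first exact: nq.
      by rewrite lef_pV2 ?posrE// divr_gt0.
    have h2 : W 0 * dual_energy f g xstar z0 <=
        2 * n%:R * (a / (eta * b)) * L * q.
      apply: le_trans (ler_wpM2l (W_ge0 0) DE) _.
      (* The Lipschitz gradients bring [L ^+ 2]; [gamma * L <= 1] removes one factor, leaving the
         same order in [L] as the primal part. *)
      have -> : W 0 * (2 * n%:R * (L ^+ 2 * q)) =
          (gamma * L) * (2 * n%:R * (a / (eta * b)) * L * q).
        by rewrite /W addr0; ring.
      apply: ler_piMl gL1; apply: mulr_ge0 q0; apply: mulr_ge0 (ltW L0).
      by apply: mulr_ge0 aeb; apply: mulr_ge0 => //; exact: ltW.
    rewrite PE /k2c (ger0_norm aeb); apply: le_trans (lerD h1 h2) _.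
    by rewrite le_eqVlt; apply/orP; left; apply/eqP; ring.
  apply: (near0_right E2) => eps e0 eE.
  have /andP[l u] := Tb eps e0 eE.
  have Le : 0 <= L / eps by rewrite divr_ge0// ltW.
  have K10 : 0 <= 2 * n%:R / k2 by rewrite divr_ge0 ?mulr_ge0// ltW.
  have ei : 0 <= eps^-1 by rewrite invr_ge0 ltW.
  rewrite q1 -!sqrtrM ?(ltW k2c0)//; apply/andP; split; apply: ler_wsqrtr.
    apply: le_trans l.
    have -> : 2 * n%:R / k2 * (L / eps * q) = 4 * n%:R / k2 * L * q / 2 * eps^-1.
      by field; rewrite !gt_eqF.
    by do 2 apply: ler_wpM2r => //.
  apply: le_trans u _.
  have -> : k2c * (L / eps * q) = k2c * L * q / eps by field; rewrite gt_eqF.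
  exact: ler_wpM2r.
Qed.
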